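(* Let $A=\{(x_1,\alpha_1),\dots,(x_N,\alpha_N)\}$ be a configuration on $S^3$, with conformal factor $\Phi$, mean $\langle\Phi\rangle$ and global modified discrepancy $E$. Let $p\in S^3\setminus\{x_1,\dots,x_N\}$, let $\lambda_{\min}=\min_{n=1,\dots,N}\Lambda(p,x_n)$, and let $0<\varepsilon\le 1$. Assume that $E+\lambda_{\min}<\frac{\pi}{2}$. Then $$\frac{\left|\Phi(p)-\langle\Phi\rangle\right|}{\langle\Phi\rangle}\le C_\varepsilon\,U_\varepsilon(E,\lambda_{\min}),$$ where $U_\varepsilon=\max(U_{1,\varepsilon},U_{2,\varepsilon},U_{3,\varepsilon})$ with $$U_{1,\varepsilon}(E,\lambda_{\min})=\frac{2\pi^\varepsilon}{3}\lambda_{\min}^{2-\varepsilon},\qquad U_{2,\varepsilon}(E,\lambda_{\min})=\frac{4E}{\pi}\left(1+2E\,\lambda_{\min}^{-\frac{1+\varepsilon}{2}}\right)^2,\qquad U_{3,\varepsilon}(E,\lambda_{\min})=\frac{4E}{\pi\cos^{1+\varepsilon}E},$$ and $$C_\varepsilon=\frac{3\pi}{16}\int_0^\pi\left|\left(\frac{1}{\sin\frac{\lambda}{2}}\right)'\right|V(\lambda)^{1+\varepsilon}\,d\lambda,\qquad V(\lambda)=\begin{cases}\sin\lambda & 0\le\lambda\le\frac{\pi}{2},\\ 1 & \frac{\pi}{2}<\lambda\le\pi.\end{cases}$$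
   Context: $S^3$ is the unit round 3-sphere with round metric $q_0$, $\Lambda(\cdot,\cdot)$ its geodesic distance, and $\mathrm{vol}$ its volume measure (total volume $2\pi^2$). A configuration $A$ is a non-empty finite set of pairs $(x_i,\alpha_i)$, $i=1,\dots,N$, where the $x_i$ are distinct points of $S^3$ (punctures) and the $\alpha_i>0$ are real numbers (mass parameters); $\alpha=\sum_{i=1}^N\alpha_i$. The conformal factor is $\Phi(x)=\sum_{n=1}^N\frac{\alpha_n}{\sin(\Lambda(x,x_n)/2)}$, and its mean is $\langle\Phi\rangle=\frac{1}{2\pi^2}\int_{S^3}\Phi\,d\mathrm{vol}$ (the integral converges). For $p\in S^3$ and $0\le\lambda\le\pi$ let $B(p,\lambda)=\{x\in S^3:\Lambda(p,x)\le\lambda\}$. The cap discrepancy function is $\mathrm{disc}_p(\lambda)=\frac{1}{2\pi^2}\mathrm{vol}(B(p,\lambda))-\sum_{x_i\in B(p,\lambda)}\frac{\alpha_i}{\alpha}$. For $D\ge 0$ let $$F_D(\lambda)=\begin{cases}\frac{4D}{\pi}\sin^2(\lambda+D) & 0\le\lambda\le\frac{\pi}{2}-D,\\ \frac{4D}{\pi} & \max(0,\frac{\pi}{2}-D)\le\lambda\le\pi.\end{cases}$$ The modified cap discrepancy at $p$, $E_p$, is the smallest $D\ge0$ such that $|\mathrm{disc}_p(\lambda)|\le F_D(\lambda)$ for all $0\le\lambda\le\pi$. The global modified discrepancy of $A$ is $E=\sup_{p\in S^3}E_p$. *)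

(* Defs.v *)
From HB Require Import structures.
From mathcomp Require Import all_boot all_order all_algebra.
From mathcomp Require Import all_classical all_reals all_analysis.
From mathcomp Require Import measurable_realfun.
Set Implicit Arguments.
Unset Strict Implicit.
Unset Printing Implicit Defensive.
Import Order.TTheory GRing.Theory Num.Theory.
Import numFieldNormedType.Exports.
Local Open Scope classical_set_scope.
Local Open Scope ring_scope.

(* R^4 as an iterated product, which carries the product sigma-algebra and the
   product Lebesgue measure. The norm that the library puts on products is the
   sup norm; the Euclidean one is [enorm4]. *)
Notation R4 R :=
  (measurableTypeR R * measurableTypeR R * measurableTypeR R *
   measurableTypeR R)%type.

Section Sphere.
Context {R : realType}.
Implicit Types (p x y v : R4 R) (l : R).

Definition dot4 x y : R :=
  x.1.1.1 * y.1.1.1 + x.1.1.2 * y.1.1.2 + x.1.2 * y.1.2 + x.2 * y.2.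

Definition enorm4 x : R := Num.sqrt (dot4 x x).

Definition direction4 v : R4 R :=
  (v.1.1.1 / enorm4 v, v.1.1.2 / enorm4 v, v.1.2 / enorm4 v, v.2 / enorm4 v).

Definition S3 : set (R4 R) := [set x | enorm4 x = 1].

(* Great-circle distance: the angle between two unit vectors, in [0, pi]. *)
Definition geodist x y : R := acos (dot4 x y).

Definition leb4 : set (R4 R) -> \bar R :=
  (((@lebesgue_measure R \x @lebesgue_measure R)
     \x @lebesgue_measure R) \x @lebesgue_measure R)%E.

HB.instance Definition _ := Measure.on leb4.

(* Surface measure of the unit sphere, as a measure on R^4 carried by [S3]:
   the volume of A is the dimension 4 times the Lebesgue measure of the cone
   { t a | 0 < t <= 1, a in A & S3 }. The origin, where [direction4] is 0, is
   Lebesgue-null. *)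
Definition volS3 (A : set (R4 R)) : \bar R :=
  (4%:E * leb4 [set v | (enorm4 v <= 1)%R /\ A (direction4 v)])%E.

Let measurable_c1 : measurable_fun setT (fun v => v.1.1.1).
Proof.
exact: (measurableT_comp measurable_fst
  (measurableT_comp measurable_fst measurable_fst)).
Qed.

Let measurable_c2 : measurable_fun setT (fun v => v.1.1.2).
Proof.
exact: (measurableT_comp measurable_snd
  (measurableT_comp measurable_fst measurable_fst)).
Qed.

Let measurable_c3 : measurable_fun setT (fun v => v.1.2).
Proof. exact: (measurableT_comp measurable_snd measurable_fst). Qed.

Let measurable_c4 : measurable_fun setT (fun v => v.2).
Proof. exact: measurable_snd. Qed.

Lemma measurable_enorm4 : measurable_fun setT enorm4.
Proof.
have msqrt : measurable_fun setT (@Num.sqrt R).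
  by apply: continuous_measurable_fun; exact: sqrt_continuous.
have mdot : measurable_fun setT (fun v => dot4 v v).
  by repeat apply: measurable_funD; apply: measurable_funM.
exact: (measurableT_comp msqrt mdot).
Qed.

Lemma measurable_direction4 : measurable_fun setT direction4.
Proof.
have mV : measurable_fun setT (fun v => (enorm4 v)^-1).
  under eq_fun do rewrite -powR_inv1 ?sqrtr_ge0//.
  exact: (measurableT_comp (measurable_powR _) measurable_enorm4).
by repeat apply: measurable_fun_pair; apply: measurable_funM.
Qed.

Lemma measurable_uball4 : measurable [set v | enorm4 v <= 1].
Proof.
rewrite -[X in measurable X]setTI.
have -> : [set v | enorm4 v <= 1] = enorm4 @^-1` `]-oo, 1%R]%classic.
  by apply/seteqP; split => v /=; rewrite in_itv.
exact: measurable_enorm4.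
Qed.

Lemma volS3E : volS3 =
  pushforward (mscale 4%:nng (mrestr leb4 measurable_uball4)) direction4.
Proof.
apply/funext => A; rewrite /pushforward /mscale /mrestr/=; congr (_ * leb4 _)%E.
by apply/seteqP; split => v /= [].
Qed.

Let volS30 : volS3 set0 = 0%E.
Proof. by rewrite volS3E; apply: measure0; exact: measurable_direction4. Qed.

Let volS3_ge0 A : (0 <= volS3 A)%E.
Proof. by rewrite volS3E; apply: measure_ge0; exact: measurable_direction4. Qed.

Let volS3_sigma_additive : semi_sigma_additive volS3.
Proof. by rewrite volS3E; apply: measure_semi_sigma_additive; exact: measurable_direction4. Qed.

HB.instance Definition _ := isMeasure.Build _ _ _ volS3
  volS30 volS3_ge0 volS3_sigma_additive.

End Sphere.

Record configuration (R : realType) := Configuration {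
  npunct : nat;
  npunct_gt0 : (0 < npunct)%N;
  puncture : 'I_npunct -> R4 R;
  mass : 'I_npunct -> R;
  puncture_S3 : forall n, S3 (puncture n);
  puncture_inj : injective puncture;
  mass_gt0 : forall n, 0 < mass n
}.

Section Configuration.
Context {R : realType}.
Implicit Types (A : configuration R) (p x : R4 R) (D l eps E lmin : R).

Definition total_mass A : R := \sum_(n < npunct A) mass n.

(* At a puncture the library's convention 0^-1 = 0 gives a junk summand; this
   is a null set for the mean, and the main statement excludes it. *)
Definition Phi A x : R :=
  \sum_(n < npunct A) mass n / sin (geodist x (puncture n) / 2).

Definition mean_Phi A : R :=
  (2 * pi ^+ 2)^-1 * \int[@volS3 R]_(x in S3) Phi A x.

Definition cap p l : set (R4 R) := [set x | S3 x /\ geodist p x <= l].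

Definition disc A p l : R :=
  (2 * pi ^+ 2)^-1 * fine (volS3 (cap p l))
  - \sum_(n < npunct A | puncture n \in cap p l) mass n / total_mass A.

Definition capF D l : R :=
  if l <= pi / 2 - D then 4 * D / pi * sin (l + D) ^+ 2 else 4 * D / pi.

(* The infimum is attained, as [capF D l] is continuous and nondecreasing in D,
   and D = pi / 2 is admissible. *)
Definition mod_disc A p : R :=
  inf [set D | 0 <= D /\ forall l, 0 <= l <= pi -> `|disc A p l| <= capF D l].

(* The supremum is over a nonempty subset of [0, pi / 2]. *)
Definition glob_mod_disc A : R := sup [set mod_disc A p | p in S3].

(* Distances are at most pi, so the default value pi of the iterated minimum
   is harmless. *)
Definition lambda_min A p : R :=
  \big[Num.min/pi]_(n < npunct A) geodist p (puncture n).

Definition U1 eps E lmin : R := 2 * pi `^ eps / 3 * lmin `^ (2 - eps).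

Definition U2 eps E lmin : R :=
  4 * E / pi * (1 + 2 * E * lmin `^ (- ((1 + eps) / 2))) ^+ 2.

Definition U3 eps E lmin : R := 4 * E / (pi * cos E `^ (1 + eps)).

Definition Umax eps E lmin : R :=
  Num.max (Num.max (U1 eps E lmin) (U2 eps E lmin)) (U3 eps E lmin).

Definition capV l : R := if l <= pi / 2 then sin l else 1.

Definition Ceps eps : R :=
  3 * pi / 16 *
  \int[@lebesgue_measure R]_(l in `[0, pi]%classic)
    (`|derive1 (fun t : R => (sin (t / 2))^-1) l| * capV l `^ (1 + eps)).

End Configuration.

(* Main.v *)
Require Import Defs.
From HB Require Import structures.
From mathcomp Require Import all_boot all_order all_algebra.
From mathcomp Require Import all_classical all_reals all_analysis.
From mathcomp Require Import measurable_realfun ring lra.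
Set Implicit Arguments.
Unset Strict Implicit.
Unset Printing Implicit Defensive.
Import Order.TTheory GRing.Theory Num.Theory.
Import numFieldNormedType.Exports.
Local Open Scope classical_set_scope.
Local Open Scope ring_scope.

(* A cap of radius l has volume fraction W l = (l - sin l cos l) / pi, whatever
   its centre. Writing 1 / sin (d / 2) = 1 + int_d^pi K with
   K l = - (1 / sin (l / 2))', Tonelli gives <Phi> = alpha (1 + int K W)
   = 16 alpha / (3 pi), and for the point p itself
     Phi p - <Phi> = - alpha int_0^pi K(l) disc_p(l) dl.
   It remains to bound |disc_p(l)| by U V(l)^(1+eps): by U1 for l < lambda_min,
   where disc_p = W <= 2 l^3 / (3 pi), and by U2 or U3 for l >= lambda_min,
   where |disc_p| <= F_E, according to whether l + E <= pi / 2.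

   That the volume of a cap does not depend on its centre is proved by running
   the uniqueness argument for Haar measure on Lebesgue measure in R^4 and its
   image under a Householder reflection, with the unit ball as test set. *)

(** * Calculus *)

(** Near 0, K behaves like 2 / l^2 and is not integrable, so bounding |disc_p| by a constant would
    give nothing. The weight V^(1+eps) brings the integrand down to the order of l^(eps-1); this is
    why [eps] must be positive and why each U is a bound for |disc_p| / V^(1+eps). The factor 3 pi /
    16 in [Ceps] is alpha / <Phi>. Volume on the sphere is defined through cones in R^4 under a
    product measure, which singles out the coordinate axes. Slicing along the last axis reaches only
    caps centred on that axis, and is done for radii up to pi / 2. Other centres are reached by one
    Householder reflection exchanging the two centres: it is a self-adjoint involutive isometry, so
    neither a determinant nor a change of variables in R^4 enters. Larger radii come from the
    complementary cap at the antipode. E is a supremum of infima. Instead of showing that the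
    infimum is attained, the bounds are obtained for every D > E and passed to the limit. *)

Section Calculus.
Context {R : realType}.
Implicit Types (f F : R -> R) (a b l x : R).
Local Notation mu := (@lebesgue_measure R).

Lemma continuous_at_is_derive F x d : is_derive x 1 F d -> {for x, continuous F}.
Proof. by case=> dF _; exact/differentiable_continuous/derivable1_diffP. Qed.

(** The integrand may blow up at an endpoint. The usual theorem applies on the compact intervals
    [D n] exhausting the open one; nonnegativity makes their integrals converge to the whole, and
    the one-sided limits of [F] give the value. *)
Lemma ge0_FTC2_oo f F a b : a < b ->
  (forall x, a < x < b -> 0 <= f x) ->
  (forall x, a < x < b -> {for x, continuous f}) ->
  (forall x, a < x < b -> is_derive x 1 F (f x)) ->
  F x @[x --> a^'+] --> F a -> F x @[x --> b^'-] --> F b ->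
  (\int[mu]_(x in `[a, b]) (f x)%:E = (F b - F a)%:E)%E.
Proof.
move=> ab f0 cf dF Fa Fb.
have mf : measurable_fun `]a, b[ f.
  apply: open_continuous_measurable_fun => //.
  by move=> x; rewrite inE/= in_itv/=; exact: cf.
rewrite integral_itv_bndoo; last exact/measurable_EFinP.
(* The denominator starts at 3 so that two margins [e n] fit strictly inside the interval already
   for [n = 0]. *)
pose e (n : nat) := (b - a) / n.+3%:R.
have e0 n : 0 < e n by rewrite divr_gt0// subr_gt0.
have e2 n : e n + e n < b - a.
  rewrite /e -mulrDr gtr_pMr ?subr_gt0// -mulr2n -[ltLHS]mulr_natr mulrC.
  by rewrite ltr_pdivrMr// mul1r ltr_nat.
have e_noninc n m : (n <= m)%N -> e m <= e n.
  move=> nm; rewrite ler_pM2l ?subr_gt0// lef_pV2 ?posrE//.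
  by rewrite ler_nat !ltnS.
have e_cvg : e n @[n --> \oo] --> 0.
  rewrite -(mulr0 (b - a)); apply: cvgM; first exact: cvg_cst.
  have := @cvg_harmonic R; rewrite -(cvg_shiftn 2)/=.
  by apply: cvg_trans; apply: near_eq_cvg; near=> n; rewrite /harmonic/= addn2.
pose D (n : nat) : set R := `[a + e n, b - e n]%classic.
have UD : \bigcup_n D n = `]a, b[%classic.
  apply/seteqP; split=> x.
    case=> n _; rewrite /D/=. rewrite !in_itv/= => /andP[h1 h2].
by have e0n := e0 n; apply/andP; split; lra.
  rewrite /= in_itv/= => /andP[ax xb].
  have xa0 : 0 < Num.min (x - a) (b - x) by rewrite lt_min !subr_gt0 ax xb.
  move/cvgrPdist_le : e_cvg => /(_ _ xa0)[n _ /(_ n (leqnn n))].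
  rewrite sub0r normrN gtr0_norm// le_min => /andP[h1 h2].
  by exists n => //; rewrite /D/= in_itv/=; apply/andP; split; lra.
have subD n x : D n x -> a < x < b.
  by rewrite /D/= in_itv/= => /andP[h1 h2]; have e0n := e0 n; apply/andP; split; lra.
have ID n : (\int[mu]_(x in D n) (f x)%:E = (F (b - e n) - F (a + e n))%:E)%E.
  rewrite EFinB; apply: continuous_FTC2.
  - by have := e2 n; lra.
  - apply: continuous_in_subspaceT => x; rewrite inE => /subD; exact: cf.
  - have h : {within D n, continuous F}.
      apply: continuous_in_subspaceT => x; rewrite inE => /subD/dF.
      exact: continuous_at_is_derive.
    have lt : a + e n < b - e n by have := e2 n; lra.
    have [_ h1 h2] := (continuous_within_itvP F lt).1 h.
    split => // x xD; have [] := dF x _ => //.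
    by apply: (subD n); apply: subset_itv_oo_cc xD.
  - move=> x xD; rewrite derive1E; apply: derive_val.
    by apply: dF; apply: (subD n); apply: subset_itv_oo_cc xD.
rewrite -UD.
have cvI : (\int[mu]_(x in D i) (f x)%:E @[i --> \oo] -->
    \int[mu]_(x in \bigcup_i D i) (f x)%:E)%E.
  apply: ge0_nondecreasing_set_cvg_integral.
  - apply/nondecreasing_seqP => n; apply/subsetPset => x.
    rewrite /D/= !in_itv/= => /andP[h1 h2].
    by have en := e_noninc _ _ (leqnSn n); apply/andP; split; lra.
  - by move=> i; exact: measurable_itv.
  - move=> i; apply/measurable_EFinP; apply: measurable_funS mf => //.
    by move=> x /subD; rewrite /= in_itv.
  - by move=> i x /subD /f0; rewrite lee_fin.
move/cvg_lim : cvI => <-//.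
apply/cvg_lim => //; under eq_fun do rewrite ID.
apply: cvg_EFin; first exact: nearW.
apply: cvgB.
  move/cvg_at_leftP : Fb; apply; split=> [n|]; first by have := e0 n; lra.
  by rewrite -[X in _ --> X]subr0; apply: cvgB => //; exact: cvg_cst.
move/cvg_at_rightP : Fa; apply; split=> [n|]; first by have := e0 n; lra.
by rewrite -[X in _ --> X]addr0; apply: cvgD => //; exact: cvg_cst.
Unshelve. all: by end_near. Qed.

End Calculus.

(** * Derivation rules stated with multiplication in R *)

Section DerivationRules.
Context {R : realType}.
Implicit Types (a b l x : R).

Lemma is_derive_cvg_right (F : R -> R) x d : is_derive x 1 F d ->
  F t @[t --> x^'+] --> F x.
Proof. by move=> /continuous_at_is_derive; exact: cvg_at_right_filter. Qed.

Lemma is_derive_cvg_left (F : R -> R) x d : is_derive x 1 F d ->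
  F t @[t --> x^'-] --> F x.
Proof. by move=> /continuous_at_is_derive; exact: cvg_at_left_filter. Qed.

Section derivation_rules.
Context (f g : R -> R) (x df dg : R).
Context (Hf : is_derive x 1 f df) (Hg : is_derive x 1 g dg).

Lemma is_derive_addf : is_derive x 1 (fun t => f t + g t) (df + dg).
Proof. exact: is_deriveD. Qed.

Lemma is_derive_oppf : is_derive x 1 (fun t => - f t) (- df).
Proof. exact: is_deriveN. Qed.

Lemma is_derive_mulf : is_derive x 1 (fun t => f t * g t) (f x * dg + g x * df).
Proof. exact: is_deriveM. Qed.

Lemma is_derive_expf n :
  is_derive x 1 (fun t => f t ^+ n) (n%:R * f x ^+ n.-1 * df).
Proof.
have -> : (fun t => f t ^+ n) = f ^+ n by apply/funext => t; rewrite exprfctE.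
exact: is_deriveX.
Qed.

Lemma is_derive_invf : f x != 0 ->
  is_derive x 1 (fun t => (f t)^-1) (- (f x) ^- 2 * df).
Proof.
move=> fx0; apply: DeriveDef; first by apply: derivableV => //; case: Hf.
by rewrite deriveV; case: Hf => // _ ->.
Qed.

Lemma is_derive_sinf : is_derive x 1 (fun t => sin (f t)) (cos (f x) * df).
Proof. exact: is_derive1_comp. Qed.

Lemma is_derive_cosf : is_derive x 1 (fun t => cos (f t)) (- sin (f x) * df).
Proof. exact: is_derive1_comp. Qed.

End derivation_rules.

Lemma is_derive_idf x : is_derive x 1 (fun t : R => t) 1.
Proof. exact: is_derive_id. Qed.

Lemma is_derive_cstf x a : is_derive x 1 (fun _ : R => a) 0.
Proof. exact: is_derive_cst. Qed.

End DerivationRules.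

(* Without [notypeclasses], the library's instances are found first and state
   derivatives with [*:] instead of [*]. *)
Ltac derive_step :=
  first [ notypeclasses refine (is_derive_idf _)
        | notypeclasses refine (is_derive_cstf _ _)
        | notypeclasses refine (is_derive_sinf _)
        | notypeclasses refine (is_derive_cosf _)
        | notypeclasses refine (is_derive_expf _ _)
        | notypeclasses refine (is_derive_addf _ _)
        | notypeclasses refine (is_derive_oppf _)
        | notypeclasses refine (is_derive_mulf _ _)
        | notypeclasses refine (is_derive_invf _ _) ].
Ltac derive_tac :=
  notypeclasses refine (is_derive_eq _ _); [by repeat derive_step|rewrite /=].

Section Kernel.
Context {R : realType}.
Implicit Types (a b l x : R).

Lemma ge0_is_derive_nondecreasing (f df : R -> R) a b : a <= b ->
  (forall x, is_derive x 1 f (df x)) ->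
  (forall x, a <= x <= b -> 0 <= df x) -> f a <= f b.
Proof.
move=> ab dF df0.
have cf : {within `[a, b], continuous f}.
  by apply: continuous_in_subspaceT => x _; exact: continuous_at_is_derive (dF x).
have [c cab E] := MVT_segment ab (fun x _ => dF x) cf.
rewrite -subr_ge0 E mulr_ge0 ?subr_ge0//; apply: df0.
by move: cab; rewrite in_itv.
Qed.

Lemma sin_le_id x : 0 <= x -> sin x <= x.
Proof.
move=> x0.
have d (t : R) : is_derive t 1 (fun t : R => t - sin t) (1 - cos t).
  by derive_tac; ring.
have := ge0_is_derive_nondecreasing x0 d.
rewrite sin0 subr0 subr_ge0; apply=> t _.
by rewrite subr_ge0 cos_le1.
Qed.

Lemma mul_cos_le_sin x : 0 <= x <= pi -> x * cos x <= sin x.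
Proof.
move=> /andP[x0 xpi].
have d (t : R) : is_derive t 1 (fun t : R => sin t - t * cos t) (t * sin t).
  by derive_tac; ring.
have := ge0_is_derive_nondecreasing x0 d.
rewrite sin0 mul0r subr0 subr_ge0; apply=> t /andP[t0 tx].
by rewrite mulr_ge0// sin_ge0_pi// t0 (le_trans tx).
Qed.

(* With [y = x / 2], [sin x = 2 sin y cos y >= 2 y (cos y)^2] and
   [(cos y)^2 >= 1 / 2]. *)
Lemma sin_ge_half x : 0 <= x <= pi / 2 -> x / 2 <= sin x.
Proof.
move=> /andP[x0 x1]; have p0 := pi_gt0 R.
have xE : x = (x / 2) *+ 2 by rewrite mulr2n -splitr.
have c2 : 0 <= cos x by rewrite cos_ge0_pihalf//; apply/andP; split; lra.
have cy : 0 <= cos (x / 2) by rewrite cos_ge0_pihalf//; apply/andP; split; lra.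
have h : x / 2 * cos (x / 2) <= sin (x / 2).
  by apply: mul_cos_le_sin; apply/andP; split; lra.
rewrite [in leRHS]xE sin_mulr2n; move: c2; rewrite {1}xE cos_mulr2n => c2.
have y0 : 0 <= x / 2 by lra.
have := ler_wpM2l cy h.
move: (cos (x / 2)) (sin (x / 2)) (x / 2) c2 cy y0 {h xE} => c s y *; nra.
Qed.

(** Primitive of [2 / pi * sin l ^+ 2], which is the area 4 pi sin^2 l of the 2-sphere at distance
    [l] from the centre divided by the total volume 2 pi^2. *)
Definition cap_fraction l : R := (l - sin l * cos l) / pi.

Lemma is_derive_cap_fraction x :
  is_derive x 1 cap_fraction (2 / pi * sin x ^+ 2).
Proof.
rewrite /cap_fraction; derive_tac.
move: (cos2sin2 x) (lt0r_neq0 (pi_gt0 R)).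
move: (@pi R) (sin x) (cos x) => P s c h P0.
have -> : c * (c * 1) = 1 - s ^+ 2 by rewrite -h; ring.
by field.
Qed.

Lemma cap_fraction0 : cap_fraction 0 = 0.
Proof. by rewrite /cap_fraction sin0 mul0r subr0 mul0r. Qed.

Lemma cap_fractionpi : cap_fraction pi = 1.
Proof. by rewrite /cap_fraction sinpi mul0r subr0 divff// gt_eqF// pi_gt0. Qed.

Lemma cap_fraction_nondecreasing a b : a <= b ->
  cap_fraction a <= cap_fraction b.
Proof.
move=> ab; apply: (ge0_is_derive_nondecreasing ab is_derive_cap_fraction).
by move=> t _; rewrite mulr_ge0// ?divr_ge0 ?pi_ge0// sqr_ge0.
Qed.

(** Both sides vanish at 0, and their derivatives compare because [sin t ^+ 2 <= t ^+ 2]. The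
    constant is the origin of the 2 / 3 in [U1]. *)
Lemma cap_fraction_le_cube l : 0 <= l -> cap_fraction l <= 2 / (3 * pi) * l ^+ 3.
Proof.
move=> l0; have p0 := pi_gt0 R.
have d (t : R) : is_derive t 1 (fun t : R => 2 / (3 * pi) * t ^+ 3 - cap_fraction t)
    (2 / pi * (t ^+ 2 - sin t ^+ 2)).
  notypeclasses refine (is_derive_eq _ _).
    notypeclasses refine (is_derive_addf _ _).
      by repeat derive_step.
    notypeclasses refine (is_derive_oppf _).
    exact: is_derive_cap_fraction.
  by rewrite /=; move: (@pi R) (lt0r_neq0 p0) => P P0; field.
have := ge0_is_derive_nondecreasing l0 d.
rewrite cap_fraction0 expr0n/= mulr0 subr0 subr_ge0; apply=> t /andP[t0 tl].
rewrite mulr_ge0// ?divr_ge0 ?pi_ge0// subr_ge0.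
rewrite -[leLHS]ger0_norm ?sqr_ge0// normrX ler_pXn2r ?nnegrE//.
have [t1|t1] := leP t 1; last by rewrite (le_trans (sin_max t))// ltW.
rewrite ger0_norm ?sin_le_id// sin_ge0_pi// t0/=; have := pi_ge2 R; lra.
Qed.

End Kernel.

(** * The kernel (1 / sin (l / 2))' *)

Section KernelIntegrals.
Context {R : realType}.
Implicit Types (a b d l x eps : R).
Local Notation mu := (@lebesgue_measure R).

(** The power with exponent -1 is the inverse on nonnegative reals, hence the detour through
    [x ^+ 2]; at 0 both expressions are 0 by the convention [0^-1 = 0]. *)
Lemma measurable_invr : measurable_fun [set: R] (@GRing.inv R).
Proof.
rewrite (_ : @GRing.inv R = fun x => x * (x ^+ 2) `^ (-1)).
  apply: measurable_funM => //.
  exact: (measurableT_comp (measurable_powR _) (measurable_funX _ _)).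
apply/funext => x; rewrite powR_inv1 ?sqr_ge0//.
by have [->|x0] := eqVneq x 0; [rewrite invr0 mul0r|field].
Qed.

(** The kernel K of the overview; [2 * sin (l / 2)] is the chord of an arc [l]. At [l = 0] it takes
    the value 0, by [0^-1 = 0], so bounds on the closed interval remain true there. *)
Definition chord_kernel l : R := cos (l / 2) / (2 * sin (l / 2) ^+ 2).

Lemma sin_half_gt0 l : 0 < l <= pi -> 0 < sin (l / 2).
Proof.
move=> /andP[l0 l1]; have p0 := pi_gt0 R.
by apply: sin_gt0_pi; apply/andP; split; lra.
Qed.

Lemma cos_half_ge0 l : 0 <= l <= pi -> 0 <= cos (l / 2).
Proof.
move=> /andP[l0 l1]; have p0 := pi_gt0 R.
by apply: cos_ge0_pihalf; apply/andP; split; lra.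
Qed.

Lemma chord_kernel_ge0 l : 0 <= l <= pi -> 0 <= chord_kernel l.
Proof. by move=> h; rewrite divr_ge0 ?cos_half_ge0// mulr_ge0// sqr_ge0. Qed.

Lemma measurable_sin_half : measurable_fun [set: R] (fun t : R => sin (t / 2)).
Proof.
apply: (measurableT_comp (continuous_measurable_fun (@continuous_sin R))).
by apply: measurable_funM; [exact: measurable_id|exact: measurable_cst].
Qed.

Lemma measurable_cos_half : measurable_fun [set: R] (fun t : R => cos (t / 2)).
Proof.
apply: (measurableT_comp (continuous_measurable_fun (@continuous_cos R))).
by apply: measurable_funM; [exact: measurable_id|exact: measurable_cst].
Qed.

Lemma measurable_chord_kernel : measurable_fun [set: R] chord_kernel.
Proof.
apply: measurable_funM; first exact: measurable_cos_half.
apply: (measurableT_comp measurable_invr); apply: measurable_funM => //.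
by apply: measurable_funX; exact: measurable_sin_half.
Qed.

Lemma is_derive_inv_sin_half x : sin (x / 2) != 0 ->
  is_derive x 1 (fun t : R => (sin (t / 2))^-1) (- chord_kernel x).
Proof.
move=> s0; rewrite /chord_kernel; derive_tac => //.
by move: (sin _) (cos _) s0 => s c s0; field.
Qed.

Lemma continuous_chord_kernel x : sin (x / 2) != 0 ->
  {for x, continuous chord_kernel}.
Proof.
move=> s0; apply: continuous_at_is_derive.
rewrite /chord_kernel; repeat derive_step.
by rewrite mulf_neq0// expf_neq0.
Qed.

Lemma derive1_inv_sin_half l : 0 < l <= pi ->
  derive1 (fun t : R => (sin (t / 2))^-1) l = - chord_kernel l.
Proof.
move=> /sin_half_gt0/lt0r_neq0/is_derive_inv_sin_half h.
by rewrite derive1E; apply: derive_val.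
Qed.

Lemma integral_chord_kernel d : 0 < d <= pi ->
  (\int[mu]_(l in `[d, pi]) (chord_kernel l)%:E = ((sin (d / 2))^-1 - 1)%:E)%E.
Proof.
move=> /andP[d0]; rewrite le_eqVlt => /predU1P[->|dpi].
  by rewrite set_itv1 integral_set1 sin_pihalf invr1 subrr.
have s0 x : d <= x <= pi -> sin (x / 2) != 0.
  by move=> /andP[dx xpi]; rewrite lt0r_neq0// sin_half_gt0// xpi (lt_le_trans d0).
have dF x : d <= x <= pi ->
    is_derive x 1 (fun t : R => - (sin (t / 2))^-1) (chord_kernel x).
  move=> /s0/is_derive_inv_sin_half h; rewrite -[X in is_derive _ _ _ X]opprK.
  exact: is_derive_oppf.
notypeclasses refine (etrans (@ge0_FTC2_oo _ _
  (fun t : R => - (sin (t / 2))^-1) _ _ _ _ _ _ _ _) _).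
- exact: dpi.
- move=> x /andP[dx xpi]; apply: chord_kernel_ge0.
  by rewrite (ltW (lt_trans d0 dx)) ltW.
- by move=> x /andP[dx xpi]; apply: continuous_chord_kernel; rewrite s0// !ltW.
- by move=> x /andP[dx xpi]; apply: dF; rewrite !ltW.
- by refine (is_derive_cvg_right (dF d _)); rewrite lexx ltW.
- by refine (is_derive_cvg_left (dF pi _)); rewrite lexx ltW.
- by rewrite sin_pihalf invr1 opprK addrC.
Qed.

Lemma cap_fraction_ge0 l : 0 <= l -> 0 <= cap_fraction l.
Proof.
by rewrite -[X in _ -> X <= _](@cap_fraction0 R); exact: cap_fraction_nondecreasing.
Qed.

(** Integration by parts: with W = [cap_fraction], the term W' / sin(l/2) equals (8 / pi) sin(l/2)
    cos(l/2)^2, whose primitive is -16 / (3 pi) cos(l/2)^3. This is the origin of 16 / (3 pi), the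
    mean of 1 / sin(d/2) over the sphere. *)
Lemma integral_chord_kernel_cap_fraction :
  (\int[mu]_(l in `[0%R, pi]) (chord_kernel l * cap_fraction l)%:E
    = (16 / (3 * pi) - 1)%:E)%E.
Proof.
have p0 := pi_gt0 R.
pose F (t : R) := - (cap_fraction t * (sin (t / 2))^-1)
  + - (16 / (3 * pi) * cos (t / 2) ^+ 3).
have s0 x : 0 < x <= pi -> sin (x / 2) != 0.
  by move=> h; rewrite lt0r_neq0// sin_half_gt0.
have dF x : 0 < x <= pi -> is_derive x 1 F (chord_kernel x * cap_fraction x).
  move=> /s0 sx.
  notypeclasses refine (is_derive_eq _ _).
    notypeclasses refine (is_derive_addf _ _); last by repeat derive_step.
    notypeclasses refine (is_derive_oppf _).
    notypeclasses refine (is_derive_mulf _ _).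
      exact: is_derive_cap_fraction.
    exact: is_derive_inv_sin_half.
  rewrite /=.
  have -> : sin x = (cos (x / 2) * sin (x / 2)) *+ 2.
    by rewrite -sin_mulr2n mulr2n -splitr.
  rewrite /chord_kernel.
  move: (@pi R) (lt0r_neq0 p0) (sin (x / 2)) (cos (x / 2)) (cap_fraction x) sx.
  move=> P P0 s c W s0'.
  by field; rewrite s0' P0.
notypeclasses refine (etrans (@ge0_FTC2_oo _ _ F _ _ _ _ _ _ _ _) _).
- exact: p0.
- move=> x /andP[x0 xpi]; apply: mulr_ge0.
    by rewrite chord_kernel_ge0// !ltW.
  by rewrite cap_fraction_ge0// ltW.
- move=> x /andP[x0 xpi]; apply: continuousM.
    by apply: continuous_chord_kernel; rewrite s0// x0 ltW.
  exact: (continuous_at_is_derive (is_derive_cap_fraction _)).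
- by move=> x /andP[x0 xpi]; apply: dF; rewrite x0 ltW.
- apply: cvgD.
    apply: cvgN; rewrite cap_fraction0 mul0r.
    (* The quotient is 0 / 0 at 0. The cubic bound on [cap_fraction] divided by
       [sin (x / 2) >= x / 4] gives this quadratic majorant. *)
    apply: (@squeeze_cvgr _ _ _ _ (cst 0) (fun x => 8 / (3 * pi) * x ^+ 2)).
    + near=> x.
      have x0 : 0 < x by near: x; exact: nbhs_right_gt.
      have xpi : x <= pi by near: x; exact: nbhs_right_le.
      have sx : 0 < sin (x / 2) by rewrite sin_half_gt0// x0.
      rewrite mulr_ge0 ?cap_fraction_ge0 ?invr_ge0// ?(ltW x0) ?(ltW sx)//=.
      rewrite ler_pdivrMr//; apply: (le_trans (cap_fraction_le_cube (ltW x0))).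
      have h : x / 2 / 2 <= sin (x / 2).
        by apply: sin_ge_half; apply/andP; split; lra.
      have -> : 2 / (3 * pi) * x ^+ 3 = 8 / (3 * pi) * x ^+ 2 * (x / 2 / 2).
        by move: (@pi R) (lt0r_neq0 p0) => P P0; field.
      rewrite ler_wpM2l// mulr_ge0 ?sqr_ge0// divr_ge0// mulr_ge0// ltW//.
    + exact: cvg_cst.
    + rewrite [X in _ --> X](_ : 0 = 8 / (3 * pi) * 0 ^+ 2); last first.
        by rewrite expr0n/= mulr0.
      by notypeclasses refine (is_derive_cvg_right _); repeat derive_step.
  by notypeclasses refine (is_derive_cvg_right _); repeat derive_step.
- by refine (is_derive_cvg_left (dF pi _)); rewrite lexx p0.
- rewrite /F cap_fraction0 cap_fractionpi sin_pihalf cos_pihalf !mul0r cos0.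
  by rewrite expr0n/= expr1n invr1 !mulr1 mulr0 oppr0 addr0 add0r opprK addrC.
Unshelve. all: by end_near. Qed.


(** Under s = sin(l/2) the integrand becomes 2 * 2^eps s^(eps-1) ds on [0, 1], convergent because
    [eps] is positive. It is the majorant of the integrand of [Ceps] used below. *)
Lemma integral_cos_half_powR eps : 0 < eps ->
  (\int[mu]_(l in `[0%R, pi])
     (2 `^ eps * (sin (l / 2) `^ (eps - 1) * cos (l / 2)))%:E
    = (2 `^ eps * (2 / eps))%:E)%E.
Proof.
move=> e0; have p0 := pi_gt0 R.
pose F (t : R) := 2 `^ eps * (2 / eps) * sin (t / 2) `^ eps.
have dpow x : 0 < x <= pi ->
    is_derive x 1 (fun t : R => sin (t / 2) `^ eps)
      (eps * sin (x / 2) `^ (eps - 1) * (cos (x / 2) * 2^-1)).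
  move=> /sin_half_gt0 sx.
  notypeclasses refine (@is_derive1_comp _ (fun t => t `^ eps) _ _ _ _ _ _).
    exact: is_derive1_powR.
  by derive_tac; rewrite mulr0 add0r mulr1.
have dF x : 0 < x <= pi ->
    is_derive x 1 F (2 `^ eps * (sin (x / 2) `^ (eps - 1) * cos (x / 2))).
  move=> /dpow h.
  notypeclasses refine (is_derive_eq (is_derive_mulf (is_derive_cstf _ _) h) _).
  rewrite mulr0 addr0.
  by move: (2 `^ eps) (sin _ `^ _) (cos _) => a s c; field; rewrite gt_eqF.
notypeclasses refine (etrans (@ge0_FTC2_oo _ _ F _ _ _ _ _ _ _ _) _).
- exact: p0.
- move=> x /andP[x0 xpi]; rewrite !mulr_ge0 ?powR_ge0 ?cos_half_ge0//.
  by rewrite !ltW.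
- move=> x /andP[x0 xpi].
  have x0pi : 0 < x <= pi by rewrite x0 ltW.
  notypeclasses refine (@continuous_at_is_derive _
    (fun t : R => 2 `^ eps * (sin (t / 2) `^ (eps - 1) * cos (t / 2))) x _ _).
  notypeclasses refine (is_derive_mulf (is_derive_cstf _ _) _).
  notypeclasses refine (is_derive_mulf _ _); last by repeat derive_step.
  notypeclasses refine (@is_derive1_comp _ (fun t => t `^ (eps - 1)) _ _ _ _ _ _).
    by apply: is_derive1_powR; exact: sin_half_gt0.
  by repeat derive_step.
- by move=> x /andP[x0 xpi]; apply: dF; rewrite x0 ltW.
- rewrite {2}/F mul0r sin0 powR0 ?gt_eqF//; apply: cvgM; first exact: cvg_cst.
  apply: (@squeeze_cvgr _ _ _ _ (cst 0) (fun t : R => t `^ eps)).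
  + near=> t.
    have t0 : 0 < t by near: t; exact: nbhs_right_gt.
    have tpi : t <= pi by near: t; exact: nbhs_right_le.
    have t20 : 0 <= t / 2 by lra.
    have st0 : 0 < sin (t / 2) by rewrite sin_half_gt0// t0.
    have st : sin (t / 2) <= t by apply: (le_trans (sin_le_id t20)); lra.
    by rewrite powR_ge0/=; apply: ge0_ler_powR => //; rewrite ?nnegrE ltW.
  + exact: cvg_cst.
  + exact: powR_cvg0.
- by refine (is_derive_cvg_left (dF pi _)); rewrite lexx p0.
- by rewrite /F sin_pihalf mul0r sin0 powR0 ?gt_eqF// powR1 mulr1 mulr0 subr0.
Unshelve. all: by end_near. Qed.

Lemma capV_ge0 l : 0 <= l <= pi -> 0 <= capV l.
Proof. by rewrite /capV; case: ifP => // _; exact: sin_ge0_pi. Qed.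

Lemma measurable_capV : measurable_fun [set: R] (@capV R).
Proof.
apply: measurable_fun_ifT => //; first exact: measurable_fun_ler.
by apply: continuous_measurable_fun; exact: continuous_sin.
Qed.

(** Up to pi / 2 this is the double-angle formula with cos <= 1. Beyond, the right-hand side is at
    least 2 sin(pi/4) >= 2 sin(pi/4) cos(pi/4) = 1. *)
Lemma capV_le_chord l : 0 <= l <= pi -> capV l <= 2 * sin (l / 2).
Proof.
move=> /andP[l0 lpi]; have p0 := pi_gt0 R; rewrite /capV; case: ifPn => lp.
  rewrite {1}(_ : l = (l / 2) *+ 2); last by rewrite mulr2n -splitr.
  rewrite sin_mulr2n mulr2n; have := cos_le1 (l / 2).
  have : 0 <= sin (l / 2) by apply: sin_ge0_pi; apply/andP; split; lra.
  by move: (sin _) (cos _) => s c; nra.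
have h : sin (pi / 4) <= sin (l / 2).
  rewrite -ltNge in lp.
  rewrite leNgt ltr_sin ?in_itv/= -?leNgt; try (apply/andP; split; lra); lra.
apply: le_trans (ler_wpM2l _ h) => //.
have E : (pi / 2 : R) = (pi / 4) *+ 2.
  by rewrite mulr2n; move: (@pi R) => P; field.
have := @sin_pihalf R; rewrite E sin_mulr2n mulr2n.
have := cos_le1 (pi / 4 : R).
have : 0 <= sin (pi / 4 : R) by apply: sin_ge0_pi; apply/andP; split; lra.
by move: (sin _) (cos _) => s c; nra.
Qed.

(** Replacing V by the chord cancels the square of the sine in the denominator of the kernel,
    leaving the exponent (1 + eps) - 2 = eps - 1. *)
Lemma chord_kernel_capV_le eps l : 0 < eps -> 0 <= l <= pi ->
  chord_kernel l * capV l `^ (1 + eps) <=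
  2 `^ eps * (sin (l / 2) `^ (eps - 1) * cos (l / 2)).
Proof.
move=> e0 lI; have /andP[l0 lpi] := lI.
move: l0; rewrite le_eqVlt => /predU1P[l0|l0].
  rewrite -l0 /chord_kernel mul0r sin0 expr0n/= mulr0 invr0 mulr0 mul0r.
  by rewrite mulr_ge0 ?powR_ge0// mulr_ge0 ?powR_ge0// cos0.
have sx : 0 < sin (l / 2) by rewrite sin_half_gt0// l0.
have h : capV l `^ (1 + eps) <= (2 * sin (l / 2)) `^ (1 + eps).
  apply: ge0_ler_powR; rewrite ?nnegrE ?capV_ge0 ?capV_le_chord//.
  - by rewrite addr_ge0// ltW.
  - by rewrite mulr_ge0// ltW.
apply: (le_trans (ler_wpM2l (chord_kernel_ge0 lI) h)).
have -> : (2 * sin (l / 2)) `^ (1 + eps) =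
    2 * 2 `^ eps * sin (l / 2) `^ (1 + eps).
  rewrite powRM ?(ltW sx)//; congr (_ * _).
  by rewrite powRD ?powRr1// pnatr_eq0 implybT.
rewrite /chord_kernel.
have -> : sin (l / 2) `^ (1 + eps) = sin (l / 2) `^ (eps - 1) * sin (l / 2) ^+ 2.
  rewrite -powR_mulrn ?ltW// -powRD; last by rewrite (gt_eqF sx) implybT.
  by congr (_ `^ _); lra.
rewrite le_eqVlt; apply/orP; left; apply/eqP.
move: (sin (l / 2) `^ (eps - 1)) (2 `^ eps) (cos (l / 2)) (lt0r_neq0 sx).
by move: (sin (l / 2)) => s u v c s0; field.
Qed.

(** This makes [Ceps] a genuine integral, and allows real-valued integrals to be compared in the
    deviation estimate. *)
Lemma integrable_chord_kernel_capV eps : 0 < eps ->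
  mu.-integrable `[0, pi]%classic
    (fun l => (chord_kernel l * capV l `^ (1 + eps))%:E).
Proof.
move=> e0; have p0 := pi_gt0 R.
have g0 l : 0 <= l <= pi -> 0 <= 2 `^ eps * (sin (l / 2) `^ (eps - 1) * cos (l / 2)).
  by move=> lI; rewrite !mulr_ge0 ?powR_ge0 ?cos_half_ge0.
pose g l := (2 `^ eps * (sin (l / 2) `^ (eps - 1) * cos (l / 2)))%:E.
apply: (@le_integrable _ (measurableTypeR R) R lebesgue_measure _ _ _ g).
- exact: measurable_itv.
- apply/measurable_EFinP; apply: measurable_funTS.
  apply: measurable_funM; first exact: measurable_chord_kernel.
  by apply: (measurableT_comp (measurable_powR _)); exact: measurable_capV.
- move=> l; rewrite /= in_itv/= => lI.
  rewrite lee_fin !ger0_norm ?g0 ?chord_kernel_capV_le//.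
  by rewrite mulr_ge0 ?powR_ge0 ?chord_kernel_ge0.
- apply/integrableP; split.
    apply/measurable_EFinP; apply: measurable_funTS.
    apply: measurable_funM => //; apply: measurable_funM.
      exact: (measurableT_comp (measurable_powR _) measurable_sin_half).
    exact: measurable_cos_half.
  have E : (\int[mu]_(l in `[0%R, pi]) `|g l| = \int[mu]_(l in `[0%R, pi]) g l)%E.
    apply: eq_integral => l; rewrite inE/= in_itv/= => lI.
    by rewrite /g ger0_norm ?g0.
  apply: (@le_lt_trans _ _ (2 `^ eps * (2 / eps))%:E); last exact: ltry.
  by rewrite -integral_cos_half_powR// -[leRHS]E.
Qed.

End KernelIntegrals.

(** * Lebesgue measure on R^4 and reflections *)

Section MeasurePreserving.
Local Open Scope ereal_scope.
Context {R : realType}.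

Definition preserves d (T : measurableType d) (m : set T -> \bar R) (f : T -> T) :=
  measurable_fun setT f /\ forall A, measurable A -> m (f @^-1` A) = m A.

(** The image measure agrees with the product measure on rectangles, which by sigma-finiteness
    determine it. *)
Lemma preserves_prod d1 d2 (T1 : measurableType d1) (T2 : measurableType d2)
    (m1 : {sigma_finite_measure set T1 -> \bar R})
    (m2 : {sigma_finite_measure set T2 -> \bar R}) (f : T1 -> T1) (g : T2 -> T2) :
  preserves m1 f -> preserves m2 g ->
  preserves (m1 \x m2) (fun z => (f z.1, g z.2)).
Proof.
move=> [mf pf] [mg pg].
have mfg : measurable_fun setT (fun z : T1 * T2 => (f z.1, g z.2)).
  by apply: measurable_fun_pair; apply: measurableT_comp.
split=> // A mA.
rewrite [RHS](@product_measure_unique _ _ _ _ _ m1 m2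
  (pushforward (m1 \x m2) (fun z => (f z.1, g z.2))))//.
move=> A1 A2 mA1 mA2.
have mf1 : measurable (f @^-1` A1) by rewrite -[X in measurable X]setTI; exact: mf.
have mg1 : measurable (g @^-1` A2) by rewrite -[X in measurable X]setTI; exact: mg.
by rewrite -pf// -pg// -product_measure1E.
Qed.

Lemma preserves_addr (c : R) :
  preserves (@lebesgue_measure R) (fun x : measurableTypeR R => (x + c)%R).
Proof.
have mf : measurable_fun setT (fun x : measurableTypeR R => (x + c)%R).
  by apply: measurable_funD.
split => // A mA.
rewrite -[LHS]/(pushforward lebesgue_measure
  (fun x : measurableTypeR R => (x + c)%R : measurableTypeR R) A).
apply/esym/lebesgue_measure_unique => //= _ [[a b]] _ <-.
rewrite /pushforward (_ : _ @^-1` _ = `](a - c)%R, (b - c)%R]%classic).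
  by rewrite !lebesgue_measure_itv/= !lte_fin ltrD2r; case: ifP => // _; congr EFin; lra.
by apply/seteqP; split => x /=; rewrite !in_itv/= ltrBlDr lerBrDr.
Qed.

End MeasurePreserving.

(* The library's own sigma-finiteness instance for [m1 \x m2] is shadowed by the
   one for subprobabilities; a separate constant makes it inferable. *)
Section SigmaFiniteProduct.
Local Open Scope ereal_scope.
Context d1 d2 (T1 : measurableType d1) (T2 : measurableType d2) (R : realType).
Context (m1 : {sigma_finite_measure set T1 -> \bar R})
  (m2 : {sigma_finite_measure set T2 -> \bar R}).

Lemma product_measure_sigma_finite : sigma_finite setT (m1 \x m2).
Proof.
have [F UF mF] := sigma_finiteT m1.
have [G UG mG] := sigma_finiteT m2.
pose H k := if @unpickle (nat * nat)%type k is Some (i, j) then F i `*` G j else set0.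
exists H => [|k].
  apply/esym/seteqP; split=> // -[x y] _.
  have [i _ Fx] : (\bigcup_i F i) x by rewrite -UF.
  have [j _ Gy] : (\bigcup_i G i) y by rewrite -UG.
  by exists (pickle (i, j)) => //; rewrite /H pickleK.
rewrite /H; case: unpickle => [[i j]|]; last by rewrite measure0.
have [mFi Foo] := mF i; have [mGj Goo] := mG j.
split; first exact: measurableX.
by rewrite product_measure1E// lte_mul_pinfty// ge0_fin_numE.
Qed.

(** [m1 \x m2] integrates over the first factor outermost. Uniqueness of the product measure
    exchanges the order, so that balls and cones can be sliced by their last coordinate. *)
Lemma product_measure_ysection (X : set (T1 * T2)) : measurable X ->
  (m1 \x m2) X = \int[m2]_y m1 (ysection X y).
Proof.
move=> mX; rewrite (@product_measure_unique _ _ _ _ _ _ _ (m1 \x^ m2))//.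
by move=> A B mA mB; exact: product_measure2E.
Qed.

Definition sigma_finite_prod := m1 \x m2.

HB.instance Definition _ := Measure.on sigma_finite_prod.

HB.instance Definition _ := Measure_isSigmaFinite.Build _ _ _
  sigma_finite_prod product_measure_sigma_finite.

End SigmaFiniteProduct.

(** * Translation invariance and measurability in R^4 *)

Section Translation.
Context {R : realType}.
Implicit Types (u v w x y p q : R4 R) (A B : set (R4 R)).

Local Notation leb := (@lebesgue_measure R).

Definition leb3 : {sigma_finite_measure set (measurableTypeR R *
    measurableTypeR R * measurableTypeR R)%type -> \bar R} :=
  sigma_finite_prod (sigma_finite_prod leb leb) leb.

Definition add4 x y : R4 R :=
  (x.1.1.1 + y.1.1.1, x.1.1.2 + y.1.1.2, x.1.2 + y.1.2, x.2 + y.2).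

Definition scale4 (a : R) x : R4 R :=
  (a * x.1.1.1, a * x.1.1.2, a * x.1.2, a * x.2).

Lemma leb4_preserves_add4 y : preserves (@leb4 R) (add4^~ y).
Proof.
pose f2 (z : measurableTypeR R * measurableTypeR R) :=
  (z.1 + y.1.1.1, z.2 + y.1.1.2).
pose f3 (z : measurableTypeR R * measurableTypeR R * measurableTypeR R) :=
  (f2 z.1, z.2 + y.1.2).
have h2 : preserves (sigma_finite_prod leb leb) f2.
  exact: (preserves_prod (m1 := leb) (m2 := leb)
    (preserves_addr _) (preserves_addr _)).
have h3 : preserves leb3 f3.
  exact: (preserves_prod (m1 := sigma_finite_prod leb leb) (m2 := leb)
    h2 (preserves_addr _)).
exact: (preserves_prod (m1 := leb3) (m2 := leb) h3 (preserves_addr _)).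
Qed.

HB.instance Definition _ := Measure_isSigmaFinite.Build _ _ _ (@leb4 R)
  (product_measure_sigma_finite leb3 leb).

Lemma measurable_fun_R4 d (T : measurableType d) (f1 f2 f3 f4 : T -> R) :
  measurable_fun setT f1 -> measurable_fun setT f2 ->
  measurable_fun setT f3 -> measurable_fun setT f4 ->
  measurable_fun setT ((fun t => (f1 t, f2 t, f3 t, f4 t)) : T -> R4 R).
Proof. by move=> *; repeat apply: measurable_fun_pair. Qed.

Lemma measurable_coords :
  [/\ measurable_fun setT (fun v : R4 R => v.1.1.1),
      measurable_fun setT (fun v : R4 R => v.1.1.2),
      measurable_fun setT (fun v : R4 R => v.1.2) &
      measurable_fun setT (fun v : R4 R => v.2)].
Proof.
split.
- exact: (measurableT_comp measurable_fst
    (measurableT_comp measurable_fst measurable_fst)).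
- exact: (measurableT_comp measurable_snd
    (measurableT_comp measurable_fst measurable_fst)).
- exact: (measurableT_comp measurable_snd measurable_fst).
- exact: measurable_snd.
Qed.

Section compositions.
Context d (T : measurableType d) (f : T -> R4 R) (mf : measurable_fun setT f).

Lemma measurable_coords_comp :
  [/\ measurable_fun setT (fun t => (f t).1.1.1),
      measurable_fun setT (fun t => (f t).1.1.2),
      measurable_fun setT (fun t => (f t).1.2) &
      measurable_fun setT (fun t => (f t).2)].
Proof.
by have [m1 m2 m3 m4] := measurable_coords; split;
  [exact: (measurableT_comp m1)|exact: (measurableT_comp m2)
  |exact: (measurableT_comp m3)|exact: (measurableT_comp m4)].
Qed.

End compositions.

Lemma measurable_fun_dot4 d (T : measurableType d) (f g : T -> R4 R) :
  measurable_fun setT f -> measurable_fun setT g ->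
  measurable_fun setT (fun t => dot4 (f t) (g t)).
Proof.
move=> /measurable_coords_comp[f1 f2 f3 f4] /measurable_coords_comp[g1 g2 g3 g4].
by repeat apply: measurable_funD; apply: measurable_funM.
Qed.

Lemma measurable_fun_add4 d (T : measurableType d) (f g : T -> R4 R) :
  measurable_fun setT f -> measurable_fun setT g ->
  measurable_fun setT (fun t => add4 (f t) (g t)).
Proof.
move=> /measurable_coords_comp[f1 f2 f3 f4] /measurable_coords_comp[g1 g2 g3 g4].
by apply: measurable_fun_R4; apply: measurable_funD.
Qed.

Lemma measurable_fun_scale4 d (T : measurableType d) (a : T -> R) (g : T -> R4 R) :
  measurable_fun setT a -> measurable_fun setT g ->
  measurable_fun setT (fun t => scale4 (a t) (g t)).
Proof.
move=> ma /measurable_coords_comp[g1 g2 g3 g4].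
by apply: measurable_fun_R4; apply: measurable_funM.
Qed.

End Translation.

(** * Householder reflections and their effect on Lebesgue measure *)

Section Reflection.
Context {R : realType}.
Implicit Types (u v w x y p q : R4 R) (A B : set (R4 R)).

(** The Householder reflection in the hyperplane orthogonal to [w]. For [w = 0] the convention
    [0^-1 = 0] makes it the identity, so exchanging a point with itself is included. *)
Definition reflection4 w x : R4 R :=
  add4 x (scale4 (- (2 * dot4 x w / dot4 w w)) w).

Definition sub4 x y : R4 R := add4 x (scale4 (-1) y).

Lemma dot4C x y : dot4 x y = dot4 y x.
Proof. by rewrite /dot4; ring. Qed.

Lemma dot4_ge0 x : 0 <= dot4 x x.
Proof. by rewrite /dot4 -!expr2 !addr_ge0 ?sqr_ge0. Qed.

Lemma dot4_eq0 x : dot4 x x = 0 -> x = (0, 0, 0, 0).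
Proof.
case: x => [[[a b] c] d]; rewrite /dot4/= => h.
have h0 (t : R) : 0 <= t * t by rewrite -expr2 sqr_ge0.
have [] := (h0 a, h0 b, h0 c, h0 d) => [[[ha hb] hc] hd].
have sq0 (t : R) : t * t = 0 -> t = 0 by move=> /eqP; rewrite mulf_eq0 orbb => /eqP.
by congr (_, _, _, _); apply: sq0; lra.
Qed.

Lemma dot4_addl x y z : dot4 (add4 x y) z = dot4 x z + dot4 y z.
Proof. by rewrite /dot4/=; ring. Qed.

Lemma dot4_addr x y z : dot4 z (add4 x y) = dot4 z x + dot4 z y.
Proof. by rewrite dot4C dot4_addl !(dot4C z). Qed.

Lemma dot4_scalel a x z : dot4 (scale4 a x) z = a * dot4 x z.
Proof. by rewrite /dot4/=; ring. Qed.

Lemma dot4_scaler a x z : dot4 z (scale4 a x) = a * dot4 z x.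
Proof. by rewrite dot4C dot4_scalel dot4C. Qed.

Lemma dot4_sub x y :
  dot4 (sub4 x y) (sub4 x y) = dot4 x x + dot4 y y - 2 * dot4 x y.
Proof.
rewrite /sub4 !(dot4_addl, dot4_addr, dot4_scalel, dot4_scaler) (dot4C y x).
by ring.
Qed.

Lemma dot4_reflection w x y :
  dot4 (reflection4 w x) (reflection4 w y) = dot4 x y.
Proof.
rewrite /reflection4 !(dot4_addl, dot4_addr, dot4_scalel, dot4_scaler).
rewrite (dot4C w y).
have [->|w0] := eqVneq (dot4 w w) 0; first by rewrite invr0; ring.
by field.
Qed.

Lemma dot4_reflectionC w x y :
  dot4 x (reflection4 w y) = dot4 (reflection4 w x) y.
Proof.
rewrite /reflection4 !(dot4_addl, dot4_addr, dot4_scalel, dot4_scaler).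
by rewrite (dot4C w y); ring.
Qed.

Lemma reflection4_add w x y :
  reflection4 w (add4 x y) = add4 (reflection4 w x) (reflection4 w y).
Proof.
rewrite /reflection4 dot4_addl; congr (_, _, _, _) => /=; ring.
Qed.

Lemma reflection4_scale w a x :
  reflection4 w (scale4 a x) = scale4 a (reflection4 w x).
Proof.
rewrite /reflection4 dot4_scalel; congr (_, _, _, _) => /=; ring.
Qed.

Lemma reflection4K w : involutive (reflection4 w).
Proof.
move=> x; rewrite {1}/reflection4.
have -> : dot4 (reflection4 w x) w = - dot4 x w.
  rewrite /reflection4 dot4_addl dot4_scalel.
  have [w0|w0] := eqVneq (dot4 w w) 0; last by field.
  rewrite w0 mulr0 addr0 (dot4_eq0 w0) /dot4/=; ring.
rewrite /reflection4; case: x => [[[a b] c] d].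
congr (_, _, _, _) => /=; ring.
Qed.

(** Since p and q have equal norms, |p - q|^2 = 2 <p, p - q>. The coefficient of the reflection is
    then -1, and p - (p - q) = q. *)
Lemma reflection4_swap p q : S3 p -> S3 q -> reflection4 (sub4 p q) p = q.
Proof.
rewrite /S3/= /enorm4 => hp hq.
have e x : Num.sqrt (dot4 x x) = 1 -> dot4 x x = 1.
  by move=> h; rewrite -[LHS]sqr_sqrtr ?dot4_ge0// h expr1n.
have [w0|w0] := eqVneq (dot4 (sub4 p q) (sub4 p q)) 0.
  rewrite /reflection4 w0 invr0 mulr0 oppr0.
  have := dot4_eq0 w0.
  case: p {hp w0} => [[[a b] c] d]; case: q {hq} => [[[a' b'] c'] d'] [] /= h1 h2 h3 h4.
  by congr (_, _, _, _) => /=; lra.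
rewrite /reflection4.
have -> : - (2 * dot4 p (sub4 p q) / dot4 (sub4 p q) (sub4 p q)) = -1.
  have E : dot4 (sub4 p q) (sub4 p q) = 2 * dot4 p (sub4 p q).
    rewrite /sub4 !(dot4_addl, dot4_addr, dot4_scalel, dot4_scaler).
    by rewrite (e _ hp) (e _ hq) (dot4C q p); ring.
  by rewrite -E divff.
case: p {hp w0} => [[[a b] c] d]; case: q {hq} => [[[a' b'] c'] d'].
by congr (_, _, _, _) => /=; ring.
Qed.

Lemma measurable_reflection4 w : measurable_fun setT (reflection4 w).
Proof.
apply: measurable_fun_add4; first exact: measurable_id.
apply: measurable_fun_scale4; last exact: measurable_cst.
apply: measurable_funN; apply: measurable_funM; last exact: measurable_cst.
apply: measurable_funM; first exact: measurable_cst.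
by apply: measurable_fun_dot4; [exact: measurable_id|exact: measurable_cst].
Qed.

Definition uball4 : set (R4 R) := [set v | enorm4 v <= 1].

Lemma uball4P v : uball4 v <-> dot4 v v <= 1.
Proof.
rewrite /uball4/= /enorm4; split=> [h|h].
  by rewrite -[leLHS]sqr_sqrtr ?dot4_ge0// expr_le1// sqrtr_ge0.
by rewrite -[leRHS]sqrtr1 ler_sqrt.
Qed.

Lemma measurable_preimage d (T : measurableType d) (f : T -> R4 R) A :
  measurable_fun setT f -> measurable A -> measurable [set t | A (f t)].
Proof. by move=> mf mA; rewrite -[X in measurable X]setTI; exact: mf. Qed.

Lemma leb4_add4 y A : measurable A -> leb4 [set x | A (add4 x y)] = leb4 A.
Proof. by have [_] := leb4_preserves_add4 y; exact. Qed.

(* Uniqueness of Haar measure: by translation invariance of [leb4] and Tonelli,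
   nu (T^-1 A) nu (B) = nu (A) nu (B) for T a reflection and B the unit ball. *)
Lemma leb4_reflection_uball w A : measurable A ->
  (leb4 uball4 * leb4 [set x | A (reflection4 w x)] = leb4 uball4 * leb4 A)%E.
Proof.
move=> mA; have mB : measurable uball4 := @measurable_uball4 R.
have mT := measurable_reflection4 w.
set T := reflection4 w in mT *.
have mTA : measurable [set x | A (T x)] by exact: measurable_preimage.
(* Starting from B x T^-1 A, translating the second variable by T y, where y is the first, gives
   [X2]. Translating the first variable of [X3] by T x, where x is the second, also gives [X2]. A
   translation of the second variable of A x B by - T y gives [X3]. Each translation acts on one
   section at a time, so it preserves the product measure. *)
pose X2 : set (R4 R * R4 R) := [set z | uball4 z.1 /\ A (add4 (T z.2) z.1)].
pose X3 : set (R4 R * R4 R) := [set z | uball4 (sub4 z.1 (T z.2)) /\ A z.1].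
have m2T : measurable_fun setT (fun z : R4 R * R4 R => T z.2).
  exact: (measurableT_comp mT).
have mX2 : measurable X2.
  apply: measurableI; apply: measurable_preimage => //.
  exact: measurable_fun_add4.
have mX3 : measurable X3.
  apply: measurableI; apply: measurable_preimage => //.
  apply: measurable_fun_add4 => //.
  by apply: measurable_fun_scale4 => //; exact: measurable_cst.
rewrite -product_measure1E//.
transitivity ((@leb4 R \x @leb4 R) X2)%E.
  apply: eq_integral => y _ /=.
  rewrite -[LHS](leb4_add4 (T y)); last first.
    by apply: measurable_xsection; exact: measurableX.
  congr leb4; apply/seteqP; split=> x; rewrite /= /xsection/= !inE/=;
    by rewrite /X2/= /T reflection4_add reflection4K.
rewrite (product_measure_ysection _ _ mX2).
transitivity ((@leb4 R \x @leb4 R) X3)%E.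
  rewrite (product_measure_ysection _ _ mX3).
  apply: eq_integral => x _ /=.
  rewrite -[RHS](leb4_add4 (T x)); last exact: measurable_ysection.
  have E y : sub4 (add4 y (T x)) (T x) = y.
    by case: y => [[[a b] c] d]; congr (_, _, _, _) => /=; ring.
  have E' y : add4 (T x) y = add4 y (T x) by congr (_, _, _, _) => /=; ring.
  by congr leb4; apply/seteqP; split=> y; rewrite /= /ysection/= !inE/=
    /X3/X2/= E E'.
transitivity ((@leb4 R \x @leb4 R) (A `*` uball4))%E; last first.
  rewrite (product_measure1E _ _ mA mB); exact: muleC.
apply: eq_integral => y _ /=.
rewrite -[RHS](leb4_add4 (scale4 (-1) (T y))); last first.
  by apply: measurable_xsection; exact: measurableX.
(* The shape of the test set matters here: |y - T x| = |x - T y|, because T is a self-adjoint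
   isometry and the ball sees only the norm. *)
have E x : uball4 (sub4 y (T x)) = uball4 (add4 x (scale4 (-1) (T y))).
  apply/propext; rewrite !uball4P -/(sub4 x (T y)) !dot4_sub !dot4_reflection.
  by rewrite (addrC (dot4 y y)) (dot4_reflectionC w y x) (dot4C _ x).
by congr leb4; apply/seteqP; split=> x; rewrite /= /xsection/= !inE/= /X3/= E => -[].
Qed.

End Reflection.

(** * Volumes of balls and caps *)

Section Slices.
Context {R : realType}.
Implicit Types (a b l r s t x y : R).
Local Notation mu := (@lebesgue_measure R).

Lemma integral_cos_subst (G : R -> R) r a b : 0 < r ->
  0 <= a -> a <= b -> b <= pi -> continuous G ->
  (\int[mu]_(x in `[(r * cos b)%R, (r * cos a)%R]) (G x)%:E =
   \int[mu]_(x in `[a, b]) (G (r * cos x) * (r * sin x))%:E)%E.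
Proof.
move=> r0 a0 ab bpi cG.
pose F x := r * cos x.
have dF x : is_derive x 1 F (- (r * sin x)).
  by rewrite /F; derive_tac; ring.
have F'E : derive1 F = (fun x => - (r * sin x)).
  by apply/funext => x; rewrite derive1E; exact: derive_val.
have cF' x : {for x, continuous (fun x => - (r * sin x))}.
  notypeclasses refine (@continuous_at_is_derive _
    (fun x : R => - (r * sin x)) x _ _).
  by repeat derive_step.
rewrite (@integration_by_substitution_decreasing _ F G)//.
- by apply: eq_integral => x _; rewrite F'E /= opprK.
- move=> x y; rewrite !in_itv/= => /andP[ax xb] /andP[ay yb] xy.
  rewrite /F ltr_pM2l// ltr_cos// in_itv/=; apply/andP; split; lra.
- by rewrite F'E => x _; exact: cF'.
- rewrite F'E; apply/cvg_ex; exists (- (r * sin a)).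
  by apply: cvg_at_right_filter; exact: cF'.
- rewrite F'E; apply/cvg_ex; exists (- (r * sin b)).
  by apply: cvg_at_left_filter; exact: cF'.
- split.
  + by move=> x _; case: (dF x).
  + exact: (is_derive_cvg_right (dF a)).
  + exact: (is_derive_cvg_left (dF b)).
- exact: continuous_subspaceT.
Qed.

Lemma integral_setT_itv (f : R -> R) a b :
  (forall x, ~~ (a <= x <= b) -> f x = 0) ->
  (\int[mu]_x (f x)%:E = \int[mu]_(x in `[a, b]) (f x)%:E)%E.
Proof.
move=> f0; rewrite [RHS]integral_mkcond/=; apply: eq_integral => x _.
rewrite patchE; case: ifPn => //; rewrite notin_setE/= in_itv/= => /negP h.
by rewrite f0.
Qed.

(** The parameter is the squared radius: a slice at height y is again of this kind, with
    [s - y ^+ 2]. A negative [s] gives the empty set, consistently with [Num.sqrt s = 0]. *)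
Definition disc2 s : set (measurableTypeR R * measurableTypeR R) :=
  [set z | z.1 ^+ 2 + z.2 ^+ 2 <= s].

Definition ball3 s :
    set (measurableTypeR R * measurableTypeR R * measurableTypeR R) :=
  [set z | z.1.1 ^+ 2 + z.1.2 ^+ 2 + z.2 ^+ 2 <= s].

Lemma measurable_le_cst d (T : measurableType d) (f : T -> R) s :
  measurable_fun setT f -> measurable [set t | f t <= s].
Proof.
move=> mf; rewrite -[X in measurable X]setTI.
have -> : [set t | f t <= s] = f @^-1` `]-oo, s]%classic.
  by apply/seteqP; split => v /=; rewrite in_itv.
exact: mf.
Qed.

Lemma measurable_disc2 s : measurable (disc2 s).
Proof.
by apply: measurable_le_cst; apply: measurable_funD; apply: measurable_funX.
Qed.

Lemma measurable_ball3 s : measurable (ball3 s).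
Proof.
apply: measurable_le_cst; repeat apply: measurable_funD; apply: measurable_funX => //.
- exact: (measurableT_comp measurable_fst).
- exact: (measurableT_comp measurable_snd).
Qed.

Lemma lebesgue_measure_sqr_le s :
  mu [set x | x ^+ 2 <= s] = (2 * Num.sqrt s)%:E.
Proof.
have [s0|s0] := leP 0 s; last first.
  rewrite ltr0_sqrtr// mulr0 (_ : [set _ | _] = set0) ?measure0//.
  by apply/seteqP; split=> x //= h; move: (le_lt_trans h s0); rewrite ltNge sqr_ge0.
rewrite (_ : [set _ | _] = `[- Num.sqrt s, Num.sqrt s]%classic).
  rewrite lebesgue_measure_itv/= lte_fin; case: ltP => h.
    by rewrite -EFinD; congr EFin; ring.
  have := sqrtr_ge0 s => h'; congr EFin; lra.
apply/seteqP; split=> x /=; rewrite in_itv/= -ler_norml -sqrtr_sqr ler_sqrt//.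
Qed.

(** Under x = r cos t the integrand becomes 2 r^2 sin^2 t, the derivative of
    [pi * r ^+ 2 * cap_fraction t]. *)
Lemma integral_disc_slices r : 0 < r ->
  (\int[mu]_(x in `[(- r)%R, r]) (2 * Num.sqrt (r ^+ 2 - x ^+ 2))%:E
    = (pi * r ^+ 2)%:E)%E.
Proof.
move=> r0; have p0 := pi_gt0 R.
have := @integral_cos_subst (fun x => 2 * Num.sqrt (r ^+ 2 - x ^+ 2)) r 0 pi r0.
rewrite cospi cos0 mulr1 mulrN1 => -> //; last 2 first.
- exact: ltW.
- move=> x; apply: cvgM; first exact: cvg_cst.
  apply: (@continuous_comp _ _ _ (fun x : R => r ^+ 2 - x ^+ 2) Num.sqrt).
    notypeclasses refine (@continuous_at_is_derive _
      (fun x : R => r ^+ 2 - x ^+ 2) x _ _).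
    by repeat derive_step.
  exact: sqrt_continuous.
rewrite (@eq_integral _ _ _ mu _ (fun x => (2 * r ^+ 2 * sin x ^+ 2)%:E)); last first.
  move=> x; rewrite inE/= in_itv/= => xI.
  have -> : r ^+ 2 - (r * cos x) ^+ 2 = (r * sin x) ^+ 2.
    by rewrite !exprMn sin2cos2; ring.
  rewrite sqrtr_sqr ger0_norm; first by congr EFin; ring.
  by rewrite mulr_ge0 ?(ltW r0)// sin_ge0_pi.
have dF x : is_derive x 1 (fun x => pi * r ^+ 2 * cap_fraction x)
    (2 * r ^+ 2 * sin x ^+ 2).
  notypeclasses refine (is_derive_eq
    (is_derive_mulf (is_derive_cstf _ _) (is_derive_cap_fraction _)) _).
  by rewrite mulr0 addr0; move: (@pi R) (lt0r_neq0 p0) => P P0; field.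
notypeclasses refine (etrans (@ge0_FTC2_oo _ _
  (fun x => pi * r ^+ 2 * cap_fraction x) _ _ _ _ _ _ _ _) _) => //.
- by move=> x _; apply: mulr_ge0; [apply: mulr_ge0 => //|]; exact: sqr_ge0.
- move=> x _.
  notypeclasses refine (@continuous_at_is_derive _
    (fun x : R => 2 * r ^+ 2 * sin x ^+ 2) x _ _).
  by repeat derive_step.
- exact: (is_derive_cvg_right (dF 0)).
- exact: (is_derive_cvg_left (dF pi)).
- by rewrite cap_fraction0 cap_fractionpi; congr EFin; ring.
Qed.

Lemma leb2_disc2 s : (mu \x mu)%E (disc2 s) = (pi * Num.sqrt s ^+ 2)%:E.
Proof.
rewrite product_measure_ysection; last exact: measurable_disc2.
rewrite (_ : (fun y => _) = fun y => (2 * Num.sqrt (s - y ^+ 2))%:E); last first.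
  apply/funext => y; rewrite -lebesgue_measure_sqr_le; congr (lebesgue_measure _).
  by apply/seteqP; split => x; rewrite /ysection/= inE /disc2/= lerBrDr.
have [s0|s0] := leP s 0.
  rewrite ler0_sqrtr// expr0n/= mulr0 integral0_eq// => y _.
  by rewrite ler0_sqrtr ?mulr0// subr_le0 (le_trans s0)// sqr_ge0.
have r0 : 0 < Num.sqrt s by rewrite sqrtr_gt0.
rewrite -integral_disc_slices//.
rewrite (@integral_setT_itv _ (- Num.sqrt s) (Num.sqrt s)); last first.
  move=> x; rewrite -ler_norml -sqrtr_sqr ler_sqrt ?(ltW s0)// -ltNge => h.
  by rewrite ler0_sqrtr ?mulr0// subr_le0 ltW.
by apply: eq_integral => y _; rewrite sqr_sqrtr ?ltW.
Qed.

Lemma leb3_ball3 s : leb3 (ball3 s) = (4 / 3 * pi * Num.sqrt s ^+ 3)%:E.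
Proof.
rewrite -[LHS]/((sigma_finite_prod mu mu \x mu)%E (ball3 s)).
rewrite product_measure_ysection; last exact: measurable_ball3.
rewrite (_ : (fun y => _) = fun y => (pi * Num.sqrt (s - y ^+ 2) ^+ 2)%:E); last first.
  apply/funext => y; rewrite -leb2_disc2; congr (_ _).
  by apply/seteqP; split => x; rewrite /ysection/= inE /ball3 /disc2/= lerBrDr.
have [s0|s0] := leP s 0.
  rewrite ler0_sqrtr// expr0n/= mulr0 integral0_eq// => y _.
  by rewrite ler0_sqrtr ?expr0n/= ?mulr0// subr_le0 (le_trans s0)// sqr_ge0.
have r0 : 0 < Num.sqrt s by rewrite sqrtr_gt0.
set r := Num.sqrt s in r0 *.
have rs : s = r ^+ 2 by rewrite sqr_sqrtr ?ltW.
rewrite (@integral_setT_itv _ (- r) r); last first.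
  move=> x; rewrite -ler_norml -sqrtr_sqr ler_sqrt ?(ltW s0)// -ltNge => h.
  by rewrite ler0_sqrtr ?expr0n/= ?mulr0// subr_le0 ltW.
rewrite (@eq_integral _ _ _ mu _ (fun x => (pi * (r ^+ 2 - x ^+ 2))%:E)); last first.
  move=> x; rewrite inE/= in_itv/= -ler_norml -sqrtr_sqr ler_sqrt ?(ltW s0)// => h.
  by rewrite rs sqr_sqrtr// -rs subr_ge0.
have dF x : is_derive x 1 (fun x => pi * (r ^+ 2 * x - 3^-1 * x ^+ 3))
    (pi * (r ^+ 2 - x ^+ 2)).
  by derive_tac; move: (@pi R) => P; field.
notypeclasses refine (etrans (@ge0_FTC2_oo _ _
  (fun x => pi * (r ^+ 2 * x - 3^-1 * x ^+ 3)) _ _ _ _ _ _ _ _) _) => //.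
- lra.
- move=> x /andP[x1 x2]; rewrite mulr_ge0 ?pi_ge0//.
  by rewrite subr_sqr mulr_ge0//; lra.
- move=> x _.
  notypeclasses refine (@continuous_at_is_derive _
    (fun x : R => pi * (r ^+ 2 - x ^+ 2)) x _ _).
  by repeat derive_step.
- exact: (is_derive_cvg_right (dF _)).
- exact: (is_derive_cvg_left (dF _)).
- by congr EFin; move: (@pi R) => P; field.
Qed.


(** Under t = cos x this is the integral of 4/3 pi sin^4 x. The result is split so that, for
    [l <= pi / 2], its second term is minus the volume of the straight cone of height cos l over a
    3-ball of radius sin l; [l = pi] gives the whole unit ball. *)
Lemma integral_ball_slices l : 0 <= l <= pi ->
  (\int[mu]_(t in `[cos l, 1%R]) (4 / 3 * pi * Num.sqrt (1 - t ^+ 2) ^+ 3)%:E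
    = (pi / 2 * (l - sin l * cos l) - pi / 3 * sin l ^+ 3 * cos l)%:E)%E.
Proof.
move=> /andP[l0 lpi]; have p0 := pi_gt0 R.
move: l0; rewrite le_eqVlt => /predU1P[<-|l0].
  by rewrite cos0 sin0 set_itv1 integral_set1; congr EFin; ring.
have := @integral_cos_subst
  (fun t => 4 / 3 * pi * Num.sqrt (1 - t ^+ 2) ^+ 3) 1 0 l ltr01.
rewrite cos0 mulr1 mul1r => -> //; last 2 first.
- exact: ltW.
- move=> x; apply: cvgM; first exact: cvg_cst.
  apply: (@continuous_comp _ _ _ (fun x : R => Num.sqrt (1 - x ^+ 2)) (fun y => y ^+ 3)).
    apply: (@continuous_comp _ _ _ (fun x : R => 1 - x ^+ 2) Num.sqrt).
      notypeclasses refine (@continuous_at_is_derive _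
        (fun x : R => 1 - x ^+ 2) x _ _).
      by repeat derive_step.
    exact: sqrt_continuous.
  exact: exprn_continuous.
rewrite (@eq_integral _ _ _ mu _ (fun x => (4 / 3 * pi * sin x ^+ 4)%:E)); last first.
  move=> x; rewrite inE/= in_itv/= !mul1r => /andP[x0 xl].
  rewrite -sin2cos2 sqrtr_sqr ger0_norm; first by congr EFin; ring.
  by rewrite sin_ge0_pi// x0 (le_trans xl).
pose F x := pi / 2 * (x - sin x * cos x) - pi / 3 * sin x ^+ 3 * cos x.
have dF x : is_derive x 1 F (4 / 3 * pi * sin x ^+ 4).
  rewrite /F; derive_tac; have := cos2sin2 x.
  move: (@pi R) (sin x) (cos x) => P s c h.
  transitivity (4 / 3 * P * s ^+ 4 - (P / 2 + P * s ^+ 2) * (c ^+ 2 - (1 - s ^+ 2))).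
    by field.
  by rewrite h subrr mulr0 subr0.
notypeclasses refine (etrans (@ge0_FTC2_oo _ _ F _ _ _ _ _ _ _ _) _) => //.
- move=> x /andP[x0 xl]; apply: mulr_ge0; first by apply: mulr_ge0; rewrite ?ltW.
  by rewrite exprn_ge0// sin_ge0_pi// !ltW// (lt_le_trans xl).
- move=> x _.
  notypeclasses refine (@continuous_at_is_derive _
    (fun x : R => 4 / 3 * pi * sin x ^+ 4) x _ _).
  by repeat derive_step.
- exact: (is_derive_cvg_right (dF _)).
- exact: (is_derive_cvg_left (dF _)).
- by rewrite /F sin0 cos0; congr EFin; ring.
Qed.

Lemma dot4_coords (v : R4 R) :
  dot4 v v = v.1.1.1 ^+ 2 + v.1.1.2 ^+ 2 + v.1.2 ^+ 2 + v.2 ^+ 2.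
Proof. by rewrite /dot4; ring. Qed.

(** A finite nonzero value: it can be cancelled in [leb4_reflection_uball], and it shows that
    [volS3] is finite. *)
Lemma leb4_uball4 : leb4 (@uball4 R) = (pi ^+ 2 / 2)%:E.
Proof.
rewrite -[LHS]/((leb3 \x mu)%E uball4) product_measure_ysection; last first.
  exact: measurable_uball4.
rewrite (_ : (fun y => _) =
    fun t => (4 / 3 * pi * Num.sqrt (1 - t ^+ 2) ^+ 3)%:E); last first.
  apply/funext => t; rewrite -leb3_ball3; congr (_ _).
  apply/seteqP; split => x; rewrite /ysection/= inE uball4P dot4_coords /ball3/=;
    by rewrite lerBrDr.
rewrite (@integral_setT_itv _ (-1) 1); last first.
  move=> x; rewrite -ler_norml -sqrtr_sqr -[X in _ <= X]sqrtr1 ler_sqrt// -ltNge => h.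
  by rewrite ler0_sqrtr ?expr0n/= ?mulr0// subr_le0 ltW.
have := @integral_ball_slices pi; rewrite cospi sinpi => ->.
  by congr EFin; field.
by rewrite pi_ge0 lexx.
Qed.

End Slices.

(** * From cones in R^4 to volumes of caps *)

Section CapVolume.
Context {R : realType}.
Implicit Types (l s t c : R) (p q v x y : R4 R).
Local Notation mu := (@lebesgue_measure R).

Lemma S3P x : S3 x <-> dot4 x x = 1.
Proof.
rewrite /S3/= /enorm4; split=> [h|->]; last by rewrite sqrtr1.
by rewrite -[LHS]sqr_sqrtr ?dot4_ge0// h expr1n.
Qed.

Lemma dot4_S3_itv p x : S3 p -> S3 x -> -1 <= dot4 p x <= 1.
Proof.
move=> /S3P hp /S3P hx.
have := dot4_ge0 (sub4 p x); have := dot4_ge0 (sub4 p (scale4 (-1) x)).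
by rewrite !dot4_sub !(dot4_scalel, dot4_scaler) hp hx => h1 h2; apply/andP; split; lra.
Qed.

Lemma acos_le (a l : R) : -1 <= a <= 1 -> 0 <= l <= pi -> (acos a <= l) = (cos l <= a).
Proof.
move=> aI lI; rewrite -[in RHS](@acosK _ a) ?in_itv//.
by rewrite !leNgt ltr_cos// in_itv/= ?acos_ge0 ?acos_lepi.
Qed.

Lemma capE p l : S3 p -> 0 <= l <= pi ->
  cap p l = [set x | S3 x /\ cos l <= dot4 p x].
Proof.
move=> hp lI; apply/seteqP; split=> x; rewrite /cap/= /geodist => -[hx h];
  by split=> //; move: h; rewrite acos_le// dot4_S3_itv.
Qed.

Lemma measurable_S3 : measurable (@S3 R).
Proof.
rewrite (_ : S3 = [set x | dot4 x x <= 1] `&` [set x | - dot4 x x <= -1]).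
  apply: measurableI; apply: measurable_le_cst; last apply: measurable_funN.
    by apply: measurable_fun_dot4; exact: measurable_id.
  by apply: measurable_fun_dot4; exact: measurable_id.
apply/seteqP; split=> x; first by move=> /S3P h; rewrite /= h.
move=> /=[h1 h2]; apply/S3P.
by apply/eqP; rewrite eq_le h1/=; lra.
Qed.

Lemma measurable_cap p l : S3 p -> 0 <= l <= pi -> measurable (cap p l).
Proof.
move=> hp lI; rewrite capE//; apply: measurableI; first exact: measurable_S3.
rewrite [X in measurable X](_ : _ = [set x | - dot4 p x <= - cos l]).
  apply: measurable_le_cst; apply: measurable_funN.
  by apply: measurable_fun_dot4; [exact: measurable_cst|exact: measurable_id].
by apply/seteqP; split=> x /=; rewrite lerN2.
Qed.

Definition north : R4 R := (0, 0, 0, 1).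

Lemma S3_north : S3 north.
Proof. by apply/S3P; rewrite /dot4/=; ring. Qed.

Definition cone p l : set (R4 R) :=
  [set v | enorm4 v <= 1 /\ cap p l (direction4 v)].

Lemma measurable_cone p l : S3 p -> 0 <= l <= pi -> measurable (cone p l).
Proof.
move=> hp lI; apply: measurableI; first exact: measurable_uball4.
exact: measurable_preimage (@measurable_direction4 R) (measurable_cap hp lI).
Qed.

Lemma direction4E v : direction4 v = scale4 (enorm4 v)^-1 v.
Proof. by rewrite /direction4 /scale4 !(mulrC (enorm4 v)^-1). Qed.

Lemma enorm4_sqr v : enorm4 v ^+ 2 = dot4 v v.
Proof. by rewrite sqr_sqrtr// dot4_ge0. Qed.

Lemma S3_direction4 v : 0 < enorm4 v -> S3 (direction4 v).
Proof.
move=> v0; apply/S3P; rewrite direction4E !(dot4_scalel, dot4_scaler) -enorm4_sqr.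
by field; rewrite gt_eqF.
Qed.

(** For radii up to pi / 2, cos l is nonnegative, so the condition cos l |v| <= v.2 can be squared
    and becomes polynomial. The hyperplane [v.2 = 0], which contains the origin where the direction
    is meaningless, is treated as a null set later. *)
Lemma cone_northP l v : 0 <= l <= pi / 2 -> v.2 != 0 ->
  cone north l v <->
  [/\ dot4 v v <= 1, 0 < v.2 & cos l ^+ 2 * dot4 v v <= v.2 ^+ 2].
Proof.
move=> /andP[l0 lp] v2; have p0 := pi_gt0 R.
have c0 : 0 <= cos l by apply: cos_ge0_pihalf; apply/andP; split; lra.
have n0 : 0 < enorm4 v.
  rewrite sqrtr_gt0 dot4_coords.
  have [] := (sqr_ge0 v.1.1.1, sqr_ge0 v.1.1.2, sqr_ge0 v.1.2) => [[[h1 h2] h3]].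
  have : 0 < v.2 ^+ 2 by rewrite exprn_even_gt0.
  by lra.
rewrite /cone/= (capE S3_north); last by apply/andP; split; lra.
have -> : (enorm4 v <= 1) = (dot4 v v <= 1).
  by apply/idP/idP => h; [exact/(uball4P v)|exact/(uball4P v)].
rewrite /=; have -> : dot4 north (direction4 v) = v.2 / enorm4 v by rewrite /dot4/=; ring.
rewrite ler_pdivlMr// -enorm4_sqr -exprMn.
have cn0 : 0 <= cos l * enorm4 v by rewrite mulr_ge0// ltW.
split=> [[h1 [_ h2]]|[h1 h2 h3]].
  have v20 : 0 < v.2 by rewrite lt_neqAle eq_sym v2 (le_trans cn0).
  by split=> //; rewrite ler_pXn2r ?nnegrE// ltW.
split=> //; split; first exact: S3_direction4.
by move: h3; rewrite ler_pXn2r ?nnegrE// ltW.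
Qed.

(** Volumes of the horizontal slices of the cone at height t: below cos l the lateral surface bounds
    a 3-ball of radius t tan l, above cos l the unit sphere bounds one of radius sqrt(1 - t^2). *)
Definition cone_slice1 l t := 4 / 3 * pi * (t * sin l / cos l) ^+ 3.
Definition cone_slice2 t := 4 / 3 * pi * Num.sqrt (1 - t ^+ 2) ^+ 3.

Lemma leb3_cone_slice l t : 0 <= l <= pi / 2 -> t != 0 ->
  leb3 (ysection (cone north l) t) =
  (((EFin \o cone_slice1 l) \_ `[0%R, cos l[) t
   + ((EFin \o cone_slice2) \_ `[cos l, 1%R]) t)%E.
Proof.
move=> lI t0; have /andP[l0 lp] := lI; have p0 := pi_gt0 R.
have c0 : 0 <= cos l by apply: cos_ge0_pihalf; apply/andP; split; lra.
have s0 : 0 <= sin l by apply: sin_ge0_pi; apply/andP; split; lra.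
have sc := cos2Dsin2 l.
have cc := cos2sin2 l.
rewrite !patchE.
have memE : forall w, ysection (cone north l) t w <->
    [/\ dot4 (w, t) (w, t) <= 1, 0 < t & cos l ^+ 2 * dot4 (w, t) (w, t) <= t ^+ 2].
  by move=> w; rewrite /ysection/= inE; exact: cone_northP.
have q0 (w : measurableTypeR R * measurableTypeR R * measurableTypeR R) :
    0 <= w.1.1 ^+ 2 + w.1.2 ^+ 2 + w.2 ^+ 2.
  by rewrite !addr_ge0 ?sqr_ge0.
case: ifPn; rewrite ?inE/= ?notin_setE/= in_itv/=; [move=> /andP[ct tc]|move=> /negP].
  rewrite ifF; last by apply/negbTE; rewrite notin_setE/= in_itv/=; lra.
  have cp : 0 < cos l by rewrite (le_lt_trans ct).
  have tp : 0 < t by rewrite lt_neqAle eq_sym t0.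
  rewrite adde0 /= /cone_slice1.
  have h0 : 0 <= t * sin l / cos l by rewrite divr_ge0// mulr_ge0.
  rewrite -{1}[t * sin l / cos l]ger0_norm// -sqrtr_sqr -leb3_ball3.
  congr (_ _); apply/seteqP; split=> w; rewrite memE /ball3/= dot4_coords/=;
    set q := _ + _ + w.2 ^+ 2.
    move=> [_ _ h]; rewrite !exprMn exprVn ler_pdivlMr ?exprn_gt0// sin2cos2.
    by move: h; rewrite mulrDr; lra.
  rewrite !exprMn exprVn ler_pdivlMr ?exprn_gt0// sin2cos2 => h.
  have h2 : cos l ^+ 2 * (q + t ^+ 2) <= t ^+ 2 by rewrite mulrDr; lra.
  (* Below height cos l the lateral constraint implies the norm constraint: cos^2 l |v|^2 <= t^2 <=
     cos^2 l. *)
  split => //; have tc2 : t ^+ 2 <= cos l ^+ 2 by rewrite ler_pXn2r ?nnegrE// ltW.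
  have := le_trans h2 tc2; rewrite -[leRHS]mulr1 ler_pM2l//.
  by rewrite exprn_gt0.
move=> nct; rewrite add0e.
case: ifPn; rewrite ?inE/= ?notin_setE/= in_itv/=;
  [move=> /andP[ct t1]|move=> /negP nct2].
  have tp : 0 < t by rewrite lt_neqAle eq_sym t0 (le_trans c0).
  rewrite /cone_slice2 -leb3_ball3.
  congr (_ _); apply/seteqP; split=> w; rewrite memE /ball3/= dot4_coords/= lerBrDr.
    by case.
  move=> h; split => //.
  have ct2 : cos l ^+ 2 <= t ^+ 2 by rewrite ler_pXn2r ?nnegrE// ltW.
  by rewrite (le_trans _ ct2)// ler_piMr ?sqr_ge0.
rewrite (_ : ysection _ _ = set0) ?measure0//.
apply/seteqP; split=> w //; rewrite memE dot4_coords/= => -[h1 tp _].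
have t1 : t <= 1.
  by rewrite -(@expr_le1 _ 2) ?(ltW tp)//; have := q0 w; lra.
case: (ltP t (cos l)) => h; first by case/negP: nct; rewrite (ltW tp).
by case/negP: nct2; rewrite h.
Qed.

(** The region is a straight cone topped by a segment of the ball. The straight part, pi / 3 sin^3 l
    cos l, cancels the second term of [integral_ball_slices]. *)
Lemma leb4_cone_north l : 0 <= l <= pi / 2 ->
  leb4 (cone north l) = (pi / 2 * (l - sin l * cos l))%:E.
Proof.
move=> lI; have /andP[l0 lp] := lI; have p0 := pi_gt0 R.
have c0 : 0 <= cos l by apply: cos_ge0_pihalf; apply/andP; split; lra.
have s0 : 0 <= sin l by apply: sin_ge0_pi; apply/andP; split; lra.
have mC : measurable (cone north l).
  by apply: measurable_cone; [exact: S3_north|apply/andP; split; lra].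
have ms1 : measurable_fun setT (cone_slice1 l).
  by apply: measurable_funM => //; apply: measurable_funX;
    apply: measurable_funM => //; apply: measurable_funM.
have ms2 : measurable_fun setT cone_slice2.
  apply: measurable_funM => //; apply: measurable_funX.
  apply: (measurableT_comp (continuous_measurable_fun (@sqrt_continuous R))).
  by apply: measurable_funB => //; exact: measurable_funX.
have g1 t : (0 <= ((EFin \o cone_slice1 l) \_ `[0%R, cos l[) t)%E.
  rewrite patchE; case: ifPn => //; rewrite inE/= in_itv/= => /andP[t0 _].
  by rewrite lee_fin mulr_ge0 ?exprn_ge0 ?divr_ge0 ?mulr_ge0 ?(ltW p0).
have g2 t : (0 <= ((EFin \o cone_slice2) \_ `[cos l, 1%R]) t)%E.
  rewrite patchE; case: ifPn => // _.
  by rewrite lee_fin mulr_ge0 ?exprn_ge0 ?mulr_ge0 ?(ltW p0).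
have m1 : measurable_fun setT ((EFin \o cone_slice1 l) \_ `[0%R, cos l[).
  apply/(measurable_restrictT _ _).1 => //; apply: measurable_funTS.
  exact/measurable_EFinP.
have m2 : measurable_fun setT ((EFin \o cone_slice2) \_ `[cos l, 1%R]).
  apply/(measurable_restrictT _ _).1 => //; apply: measurable_funTS.
  exact/measurable_EFinP.
rewrite -[LHS]/((leb3 \x mu)%E (cone north l)) product_measure_ysection//.
(* The slice formula excludes height 0; that single height is removed here and restored once the
   integrand is rewritten. *)
rewrite -(@integral_setD1 _ _ 0); last 2 first.
- exact: measurableD.
- by apply: measurable_funTS; exact: measurable_fun_ysection.
rewrite (@eq_integral _ _ _ mu _ (fun t =>
    ((EFin \o cone_slice1 l) \_ `[0%R, cos l[) t
   + ((EFin \o cone_slice2) \_ `[cos l, 1%R]) t)%E); last first.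
  by move=> t; rewrite inE/= => -[_ /eqP t0]; exact: leb3_cone_slice.
rewrite integral_setD1; last 2 first.
- exact: measurableD.
- by apply: measurable_funTS; exact: emeasurable_funD.
rewrite ge0_integralD// -!integral_mkcond.
rewrite [X in (_ + X)%E]integral_ball_slices; last by rewrite l0; lra.
rewrite integral_itv_bndo_bndc; last first.
  by apply: measurable_funTS; exact/measurable_EFinP.
have -> : (\int[mu]_(x in `[0%R, cos l]) (EFin \o cone_slice1 l) x =
    (pi / 3 * sin l ^+ 3 * cos l)%:E)%E.
  move: c0; rewrite le_eqVlt => /predU1P[<-|cp].
    by rewrite set_itv1 integral_set1 mulr0.
  pose F (x : R) := pi / 3 * (sin l / cos l) ^+ 3 * x ^+ 4.
  have dF (x : R) : is_derive x 1 F (cone_slice1 l x).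
    rewrite /F /cone_slice1; derive_tac; move: (lt0r_neq0 cp).
    by move: (@pi R) (sin l) (cos l) => P s c c0; field.
  notypeclasses refine (etrans (@ge0_FTC2_oo _ _ F _ _ _ _ _ _ _ _) _) => //.
  + move=> x /andP[x0 _]; rewrite /cone_slice1.
    apply: mulr_ge0; first by rewrite mulr_ge0// ltW.
    by rewrite exprn_ge0// divr_ge0 ?mulr_ge0 ?(ltW x0) ?(ltW cp).
  + move=> x _.
    notypeclasses refine (@continuous_at_is_derive _
      (fun x : R => 4 / 3 * pi * (x * sin l / cos l) ^+ 3) x _ _).
    by repeat derive_step.
  + exact: (is_derive_cvg_right (dF _)).
  + exact: (is_derive_cvg_left (dF _)).
  + rewrite /F; congr EFin; move: (lt0r_neq0 cp).
    by move: (@pi R) (sin l) (cos l) => P s c c0'; field.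
by rewrite -EFinD; congr EFin; ring.
Qed.

Lemma enorm4_reflection w v : enorm4 (reflection4 w v) = enorm4 v.
Proof. by rewrite /enorm4 dot4_reflection. Qed.

Lemma cone_reflection p q l v : S3 p -> S3 q ->
  cone q l (reflection4 (sub4 p q) v) = cone p l v.
Proof.
move=> hp hq; set w := sub4 p q.
have hd : direction4 (reflection4 w v) = reflection4 w (direction4 v).
  by rewrite !direction4E enorm4_reflection reflection4_scale.
rewrite /cone/= enorm4_reflection hd /cap/= /S3/= enorm4_reflection /geodist.
by rewrite dot4_reflectionC -{1}(reflection4_swap hp hq) reflection4K.
Qed.

(** The reflection exchanging [p] and [north] carries one cone to the other, and the measure of the
    unit ball cancels. *)
Lemma leb4_cone p l : S3 p -> 0 <= l <= pi / 2 ->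
  leb4 (cone p l) = (pi / 2 * (l - sin l * cos l))%:E.
Proof.
move=> hp lI; have p0 := pi_gt0 R; rewrite -(leb4_cone_north lI).
have mC : measurable (cone north l).
  apply: measurable_cone; first exact: S3_north.
  by case/andP: lI => *; apply/andP; split; lra.
have := leb4_reflection_uball (sub4 p north) mC.
rewrite (_ : [set x | _] = cone p l); last first.
  by apply/funext => v; rewrite /= cone_reflection//; exact: S3_north.
rewrite leb4_uball4 => /(congr1 (fun z : \bar R => (pi ^+ 2 / 2)^-1%:E * z)%E).
have k0 : pi ^+ 2 / 2 != 0 :> R by rewrite gt_eqF// divr_gt0// exprn_gt0.
rewrite !muleA -EFinM (mulVf k0) !mul1e => E; exact: E.
Qed.

Lemma volS3_cap_half p l : S3 p -> 0 <= l <= pi / 2 ->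
  volS3 (cap p l) = (2 * pi ^+ 2 * cap_fraction l)%:E.
Proof.
move=> hp lI; rewrite /volS3 -/(cone p l) leb4_cone// -EFinM; congr EFin.
rewrite /cap_fraction; move: (@pi R) (lt0r_neq0 (pi_gt0 R)) => P P0.
by move: (sin l) (cos l) => s c; field.
Qed.

Definition antipode p := scale4 (-1) p.

Lemma S3_antipode p : S3 p -> S3 (antipode p).
Proof. by rewrite !S3P /antipode !(dot4_scalel, dot4_scaler) => ->; ring. Qed.

Lemma volS3U (A B : set (R4 R)) : measurable A -> measurable B ->
  A `&` B = set0 -> volS3 (A `|` B) = (volS3 A + volS3 B)%E.
Proof. exact: measureU. Qed.

(* The sphere [geodist p x = l] lies in all the shells between the radii
   [l - e] and [l], whose volume tends to 0. *)
Lemma volS3_cap_boundary p l : S3 p -> 0 < l <= pi / 2 ->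
  volS3 [set x | S3 x /\ dot4 p x = cos l] = 0%E.
Proof.
move=> hp /andP[l0 lp]; have p0 := pi_gt0 R.
set D := [set x | _].
have mD : measurable D.
  rewrite (_ : D = cap p l `&` [set x | dot4 p x <= cos l]).
    apply: measurableI; first by apply: measurable_cap => //; apply/andP; split; lra.
    by apply: measurable_le_cst; apply: measurable_fun_dot4;
      [exact: measurable_cst|exact: measurable_id].
  rewrite capE//; last by apply/andP; split; lra.
  apply/seteqP; split=> x /=; first by move=> [hx ->]; split; rewrite ?lexx.
  by move=> [[hx h1] h2]; split=> //; apply/eqP; rewrite eq_le h1 h2.
have bound l' : 0 <= l' < l ->
    (volS3 D <= (2 * pi ^+ 2 * (cap_fraction l - cap_fraction l'))%:E)%E.
  move=> /andP[l'0 l'l].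
  have l'I : 0 <= l' <= pi by apply/andP; split; lra.
  have lI : 0 <= l <= pi by apply/andP; split; lra.
  have disj : cap p l' `&` D = set0.
    apply/seteqP; split=> x //; rewrite capE// => -[/= [_ h1] [_ h2]].
    have : cos l < cos l' by rewrite ltr_cos// in_itv.
    by rewrite -h2 ltNge h1.
  have : (volS3 (cap p l' `|` D) <= volS3 (cap p l))%E.
    apply: le_measure; rewrite ?inE.
    - by apply: measurableU => //; exact: measurable_cap.
    - exact: measurable_cap.
    - rewrite !capE// => x /= [[hx h]|[hx ->]]; split=> //.
      apply: le_trans h; apply: ltW.
      by rewrite ltr_cos// in_itv.
  rewrite volS3U//; last exact: measurable_cap.
  have l'I2 : 0 <= l' <= pi / 2 by apply/andP; split; lra.
  have lI2 : 0 <= l <= pi / 2 by apply/andP; split; lra.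
  rewrite !volS3_cap_half//.
  by rewrite -leeBrDl// -EFinB -mulrBr.
apply/eqP; rewrite eq_le measure_ge0 andbT.
apply/lee_addgt0Pr => e e0; rewrite add0e.
have /continuous_at_is_derive := is_derive_cap_fraction l.
have k0 : 0 < 2 * pi ^+ 2 :> R by rewrite mulr_gt0// exprn_gt0.
have e'0 : 0 < e / (2 * pi ^+ 2) by rewrite divr_gt0.
move=> /cvg_at_left_filter/cvgrPdist_le/(_ _ e'0) H.
have [l' [l'I hl']] : exists l', 0 <= l' < l /\
    `|cap_fraction l - cap_fraction l'| <= e / (2 * pi ^+ 2).
  have : \forall l' \near l^'-, 0 <= l' < l /\
      `|cap_fraction l - cap_fraction l'| <= e / (2 * pi ^+ 2).
    near=> l'; split; last by near: l'.
    apply/andP; split; first by near: l'; exact: nbhs_left_ge.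
    by near: l'; exact: nbhs_left_lt.
  by move=> /filter_ex.
apply: (le_trans (bound _ l'I)); rewrite lee_fin.
rewrite mulrC -ler_pdivlMr//; apply: le_trans hl'; exact: ler_norm.
Unshelve. all: by end_near. Qed.

Lemma measurable_dot4_eq p c : measurable [set x | S3 x /\ dot4 p x = c].
Proof.
have md : measurable_fun setT (dot4 p).
  by apply: measurable_fun_dot4; [exact: measurable_cst|exact: measurable_id].
apply: measurableI; first exact: measurable_S3.
rewrite [X in measurable X](_ : _ = dot4 p @^-1` [set c])//.
by rewrite -[X in measurable X]setTI; exact: md.
Qed.

(** The two caps cover the sphere and meet only in their common boundary, which is null. This
    extends the volume formula beyond the hemisphere. *)
Lemma volS3_cap_complement p m : S3 p -> 0 < m <= pi / 2 ->
  volS3 (@S3 R) = (volS3 (cap p (pi - m)) + volS3 (cap (antipode p) m))%E.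
Proof.
move=> hp mI; have /andP[m0 mp] := mI; have p0 := pi_gt0 R.
have hq := S3_antipode hp.
have mI' : 0 <= m <= pi by apply/andP; split; lra.
have mI'' : 0 <= pi - m <= pi by apply/andP; split; lra.
have cE : cos (pi - m) = - cos m by rewrite cosB cospi sinpi mul0r addr0 mulN1r.
have dE x : dot4 (antipode p) x = - dot4 p x by rewrite dot4_scalel mulN1r.
have mq := measurable_cap hq mI'.
have mp' := measurable_cap hp mI''.
set D := [set x | S3 x /\ dot4 (antipode p) x = cos m].
have D0 : volS3 D = 0%E by exact: volS3_cap_boundary.
have mD : measurable D by exact: measurable_dot4_eq.
have -> : volS3 (cap (antipode p) m) = volS3 (cap (antipode p) m `\` D).
  rewrite -[in LHS](@setDUK _ D (cap (antipode p) m)); last first.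
    by move=> x [hx h]; rewrite capE//=; split=> //; rewrite h.
  rewrite volS3U//; last 2 first.
  - exact: measurableD.
  - exact: setDIK.
  by rewrite D0 add0e.
rewrite -volS3U//; last 2 first.
- exact: measurableD.
- apply/seteqP; split=> x //; rewrite !capE//= => -[[hx h1] [[_ h2] h3]].
  by apply: h3; split=> //; move: h1 h2; rewrite cE dE => *; lra.
congr volS3; apply/seteqP; split=> x; rewrite !capE//=; last first.
  by case=> [[]|[[]]].
move=> hx; have [h|h] := leP (cos (pi - m)) (dot4 p x); first by left.
right; move: h; rewrite cE => h; split.
  by split=> //; rewrite dE; lra.
by move=> [_]; rewrite dE => h2; lra.
Qed.

Lemma cap_fraction_compl m : cap_fraction (pi - m) = 1 - cap_fraction m :> R.
Proof.
rewrite /cap_fraction sinB cosB sinpi cospi.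
move: (@pi R) (lt0r_neq0 (pi_gt0 R)) => P P0.
by move: (sin m) (cos m) => s c; field.
Qed.

Lemma volS3_S3 : volS3 (@S3 R) = (2 * pi ^+ 2)%:E.
Proof.
have p0 := pi_gt0 R; pose h : R := pi / 2.
have hI : 0 <= h <= pi / 2 by rewrite /h; apply/andP; split; lra.
rewrite (volS3_cap_complement S3_north (m := pi / 2)); last by rewrite lexx divr_gt0.
have -> : pi - pi / 2 = pi / 2 :> R by lra.
rewrite !volS3_cap_half//; [|exact/S3_antipode/S3_north|exact: S3_north].
rewrite -EFinD; congr EFin.
have : cap_fraction (pi - pi / 2) = 1 - cap_fraction (pi / 2) :> R.
  exact: cap_fraction_compl.
have -> : pi - pi / 2 = pi / 2 :> R by lra.
by move=> E; rewrite -mulrDr {2}E addrC subrK mulr1.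
Qed.

Lemma volS3_cap p l : S3 p -> 0 <= l <= pi ->
  volS3 (cap p l) = (2 * pi ^+ 2 * cap_fraction l)%:E.
Proof.
move=> hp /andP[l0]; have p0 := pi_gt0 R.
rewrite le_eqVlt => /predU1P[->|lpi].
  rewrite cap_fractionpi mulr1 -volS3_S3; congr volS3.
  rewrite capE//; last by rewrite lexx ltW.
  apply/seteqP; split=> x /=; first by case.
  by move=> hx; split=> //; rewrite cospi; case/andP: (dot4_S3_itv hp hx).
have [lp|lp] := leP l (pi / 2); first by apply: volS3_cap_half => //; rewrite l0.
have mI : 0 < pi - l <= pi / 2 by apply/andP; split; lra.
have mI' : 0 <= pi - l <= pi / 2 by apply/andP; split; lra.
have := volS3_cap_complement hp mI.
rewrite opprB addrCA subrr addr0 volS3_S3 (volS3_cap_half (S3_antipode hp))//.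
rewrite cap_fraction_compl mulrBr mulr1.
by case: (volS3 (cap p l)) => [r| |]//; rewrite -EFinD => -[h]; congr EFin; lra.
Qed.

End CapVolume.

(** * Mean and deviation of the potential *)

Section MeanPotential.
Context {R : realType}.
Implicit Types (l t : R) (p q x y : R4 R).
Local Notation mu := (@lebesgue_measure R).

(** Finiteness supplies the sigma-finite structure needed by Tonelli's theorem. *)
Let volS3_finite : fin_num_fun (@volS3 R).
Proof.
apply: lty_fin_num_fun; rewrite /volS3 (@le_lt_trans _ _ (4%:E * leb4 (@uball4 R))%E)//.
  rewrite lee_pmul2l ?lte_fin//; apply: le_measure; rewrite ?inE.
  - apply: measurableI; first exact: measurable_uball4.
    exact: measurable_preimage (@measurable_direction4 R) measurableT.
  - exact: measurable_uball4.
  - by move=> v [].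
by rewrite leb4_uball4 -EFinM ltry.
Qed.

HB.instance Definition _ := Measure_isFinite.Build _ _ _ (@volS3 R) volS3_finite.

Lemma geodist_itv p q : S3 p -> S3 q -> 0 <= geodist p q <= pi.
Proof. by move=> hp hq; rewrite acos_ge0 ?acos_lepi ?dot4_S3_itv. Qed.

Lemma geodistC p q : geodist p q = geodist q p.
Proof. by rewrite /geodist dot4C. Qed.

Lemma dot4_eq1 p q : S3 p -> S3 q -> dot4 p q = 1 -> p = q.
Proof.
move=> /S3P hp /S3P hq h; have := dot4_sub p q; rewrite hp hq h => E.
have /dot4_eq0 : dot4 (sub4 p q) (sub4 p q) = 0 by rewrite E; lra.
case: p {hp h E} => [[[a b] c] d]; case: q {hq} => [[[a' b'] c'] d'].
by case=> /= h1 h2 h3 h4; congr (_, _, _, _); lra.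
Qed.

Lemma geodist_gt0 p q : S3 p -> S3 q -> p <> q -> 0 < geodist p q.
Proof.
move=> hp hq pq; have /andP[h1 h2] := dot4_S3_itv hp hq.
apply: acos_gt0; rewrite h1/= lt_neqAle h2 andbT; apply/eqP => h.
exact/pq/dot4_eq1.
Qed.

(** The half-angle formula removes the arc cosine, so measurability of 1 / sin(d/2) reduces to that
    of a square root and an inverse. *)
Lemma sin_half_geodist p q : S3 p -> S3 q ->
  sin (geodist p q / 2) = Num.sqrt ((1 - dot4 p q) / 2).
Proof.
move=> hp hq; have dI := geodist_itv hp hq; have p0 := pi_gt0 R.
rewrite -[in RHS](@acosK _ (dot4 p q)) ?in_itv/= ?dot4_S3_itv// -/(geodist p q).
have -> : (1 - cos (geodist p q)) / 2 = sin (geodist p q / 2) ^+ 2.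
  rewrite {1}(_ : geodist p q = (geodist p q / 2) *+ 2); last first.
    by rewrite mulr2n -splitr.
  by rewrite cos_mulr2n sin2cos2; lra.
rewrite sqrtr_sqr ger0_norm//; apply: sin_ge0_pi.
by case/andP: dI => *; apply/andP; split; lra.
Qed.

Lemma measurable_inv_sin_half_geodist q : S3 q ->
  measurable_fun (@S3 R) (fun x => (sin (geodist x q / 2))^-1).
Proof.
move=> hq.
apply: (@eq_measurable_fun _ _ _ _ _ (fun x => (Num.sqrt ((1 - dot4 x q) / 2))^-1)).
  by move=> x; rewrite inE => hx; rewrite sin_half_geodist.
apply: measurable_funTS; apply: (measurableT_comp (@measurable_invr R)).
apply: (measurableT_comp (continuous_measurable_fun (@sqrt_continuous R))).
apply: measurable_funM => //; apply: measurable_funB => //.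
by apply: measurable_fun_dot4; [exact: measurable_id|exact: measurable_cst].
Qed.

Lemma measurable_cap_fraction : measurable_fun [set: R] (@cap_fraction R).
Proof.
apply: continuous_measurable_fun => x.
exact: (continuous_at_is_derive (is_derive_cap_fraction x)).
Qed.

Lemma inv_sin_half_ge1 t : 0 < t <= pi -> 1 <= (sin (t / 2))^-1.
Proof.
by move=> tI; rewrite invf_ge1 ?sin_half_gt0//; exact: sin_le1.
Qed.

Lemma integral_chord_kernel_indic t : 0 < t <= pi ->
  (\int[mu]_(l in `[0%R, pi]) (chord_kernel l * (t <= l)%R%:R)%:E
    = ((sin (t / 2))^-1 - 1)%:E)%E.
Proof.
move=> tI; rewrite -integral_chord_kernel//; have /andP[t0 tpi] := tI.
rewrite integral_mkcond [RHS]integral_mkcond; apply: eq_integral => l _.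
rewrite !patchE; case: ifPn; rewrite ?inE/= ?notin_setE/= in_itv/=.
  move=> /andP[l0 lpi]; case: ifPn; rewrite ?inE/= ?notin_setE/= in_itv/= lpi andbT.
    by move=> ->; rewrite mulr1.
  by move=> /negP/negbTE ->; rewrite mulr0.
move=> h; rewrite ifF//; apply/negbTE; rewrite notin_setE/= in_itv/=.
by move=> /andP[tl lpi]; apply: h; rewrite lpi andbT (le_trans (ltW t0)).
Qed.

Lemma integral_inv_sin_half_geodist q : S3 q ->
  (\int[@volS3 R]_(x in S3) ((sin (geodist x q / 2))^-1)%:E
    = (2 * pi ^+ 2 * (16 / (3 * pi)))%:E)%E.
Proof.
move=> hq; have p0 := pi_gt0 R.
(* The region d(q, x) <= l, written with cosines to make it measurable. Integrating K over it in l
   first gives 1 / sin(d/2) - 1 for x other than q; in x first it gives K(l) times the volume of a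
   cap. *)
pose X : set (R4 R * measurableTypeR R) :=
  [set z | [/\ S3 z.1, 0 <= z.2 <= pi & cos z.2 <= dot4 q z.1]].
have mX : measurable X.
  rewrite (_ : X = (fst @^-1` S3 `&` snd @^-1` `[0, pi]%classic)
      `&` [set z | cos z.2 - dot4 q z.1 <= 0]).
    apply: measurableI; first apply: measurableI.
    - rewrite -[X in measurable X]setTI.
      by apply: measurable_fst => //; exact: measurable_S3.
    - rewrite -[X in measurable X]setTI.
      by apply: measurable_snd => //; exact: measurable_itv.
    - apply: measurable_le_cst; apply: measurable_funB.
        apply: (measurableT_comp (continuous_measurable_fun (@continuous_cos R))).
        exact: measurable_snd.
      by apply: measurable_fun_dot4; [exact: measurable_cst|exact: measurable_fst].
  apply/seteqP; split=> -[x l]; rewrite /X/= in_itv/= subr_le0; first by case.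
  by move=> [[]].
pose f (z : R4 R * measurableTypeR R) := (chord_kernel z.2 * \1_X z)%:E.
have mf : measurable_fun setT f.
  apply/measurable_EFinP; apply: measurable_funM; last exact: measurable_indic.
  exact: (measurableT_comp measurable_chord_kernel).
have f0 z : (0 <= f z)%E.
  rewrite lee_fin indicE; case: (boolP (z \in X)) => [|_]; last by rewrite mulr0.
  by rewrite inE => -[_ h _]; rewrite mulr1 chord_kernel_ge0.
have XE x l : S3 x -> 0 <= l <= pi -> ((x, l) \in X) = (geodist x q <= l).
  move=> hx lI; rewrite geodistC /geodist acos_le ?dot4_S3_itv//.
  by apply/idP/idP; rewrite inE /X/=; [case|move=> h; split].
have Xout x l : ~ S3 x \/ ~~ (0 <= l <= pi) -> (x, l) \in X = false.
  move=> h; apply/negbTE; rewrite notin_setE /X/= => -[h1 h2 _].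
  by case: h => [//|/negP].
have inner2 l : (\int[@volS3 R]_x f (x, l) =
    ((fun l => (chord_kernel l * cap_fraction l * (2 * pi ^+ 2))%:E) \_ `[0%R, pi]) l)%E.
  rewrite patchE; case: ifPn; rewrite ?inE/= ?notin_setE/= in_itv/= => lI; last first.
    by rewrite integral0_eq// => x _; rewrite /f indicE Xout ?mulr0//; right; apply/negP.
  rewrite (@eq_integral _ _ _ _ _ (fun x => (chord_kernel l)%:E * (\1_(cap q l) x)%:E)%E).
    rewrite ge0_integralZl_EFin ?chord_kernel_ge0//; last first.
      by apply/measurable_EFinP; apply: measurable_indic; exact: measurable_cap.
    rewrite integral_indic//; last exact: measurable_cap.
    by rewrite setIT -[X in (_ * X)%E]/(volS3 (cap q l)) volS3_cap//
      -EFinM; congr EFin; ring.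
  move=> x _; rewrite /f -EFinM !indicE; congr (_ * _%:R)%:E.
  have -> : ((x, l) \in X) = (x \in cap q l) => //.
  by apply/idP/idP; rewrite !inE /X capE//= => -[].
have inner1 x : S3 x -> x <> q ->
    (\int[mu]_l f (x, l) = ((sin (geodist x q / 2))^-1 - 1)%:E)%E.
  move=> hx xq; rewrite -integral_chord_kernel_indic; last first.
    by rewrite geodist_gt0//; case/andP: (geodist_itv hx hq).
  rewrite [RHS]integral_mkcond; apply: eq_integral => l _; rewrite patchE.
  rewrite /f indicE; case: ifPn; rewrite ?inE/= ?notin_setE/= in_itv/= => lI.
    by rewrite XE.
  by rewrite Xout ?mulr0//; right; apply/negP.
have inner1_out x : ~ S3 x -> (\int[mu]_l f (x, l) = 0)%E.
  by move=> hx; rewrite integral0_eq// => l _; rewrite /f indicE Xout ?mulr0//; left.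
(* At x = q the integrand is [0^-1 = 0], and the bound below by 1 fails. The point is null, being a
   cap of radius 0. *)
have qE : [set q] = cap q 0.
  rewrite capE ?lexx ?ltW// cos0; apply/seteqP; split=> x /=.
    by move=> ->; split=> //; move/S3P : hq => ->.
  move=> [hx h]; apply/esym/dot4_eq1 => //.
  by apply/eqP; rewrite eq_le h; case/andP: (dot4_S3_itv hq hx) => _ ->.
have q0 : volS3 [set q] = 0%E.
  by rewrite qE volS3_cap ?lexx ?ltW// cap_fraction0 mulr0.
have mq : measurable [set q] by rewrite qE; apply: measurable_cap; rewrite ?lexx ?ltW.
have mS := @measurable_S3 R.
have mSq : measurable (S3 `\ q) by exact: measurableD.
have mh := measurable_inv_sin_half_geodist hq.
have h1 x : (S3 `\ q) x -> 1 <= (sin (geodist x q / 2))^-1.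
  move=> [hx xq]; apply: inv_sin_half_ge1; rewrite geodist_gt0//.
  by case/andP: (geodist_itv hx hq).
rewrite (ge0_negligible_integral (N := [set q]))//; last 2 first.
- exact/measurable_EFinP.
- move=> x hx; rewrite lee_fin invr_ge0 sin_ge0_pi//.
  by case/andP: (geodist_itv hx hq) => *; apply/andP; split; lra.
(* Splitting off 1, the value of 1 / sin(l/2) at l = pi, leaves a nonnegative function that is an
   integral of K; the constant contributes the total volume. *)
rewrite (@eq_integral _ _ _ _ _
    (fun x => ((sin (geodist x q / 2))^-1 - 1)%:E + 1)%E); last first.
  by move=> x _; rewrite -EFinD subrK.
have mhq : measurable_fun (S3 `\ q) (fun x => (sin (geodist x q / 2))^-1).
  by apply: measurable_funS mh => // x [].
rewrite ge0_integralD//; last 2 first.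
- by move=> x /h1; rewrite lee_fin subr_ge0.
- by apply/measurable_EFinP; apply: measurable_funB.
have -> : (\int[@volS3 R]_(x in S3 `\ q) 1 = (2 * pi ^+ 2)%:E)%E.
  rewrite -(ge0_negligible_integral mq mS)// integral_cst//.
  by rewrite mul1e -[LHS]/(volS3 S3) volS3_S3.
have mI : measurable_fun setT (fun x => \int[mu]_l f (x, l))%E.
  exact: measurable_fun_fubini_tonelli_F.
have I0 x : (0 <= \int[mu]_l f (x, l))%E by exact: integral_ge0.
rewrite (@eq_integral _ _ _ _ _ (fun x => \int[mu]_l f (x, l))%E); last first.
  by move=> x; rewrite inE => -[hx xq]; rewrite inner1.
rewrite -(ge0_negligible_integral mq mS)//; last exact: measurable_funTS.
have -> : (\int[@volS3 R]_(x in S3) \int[mu]_l f (x, l) =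
    \int[@volS3 R]_x \int[mu]_l f (x, l))%E.
  rewrite integral_mkcond; apply: eq_integral => x _; rewrite patchE.
  by case: ifPn => //; rewrite notin_setE => /inner1_out.
rewrite (fubini_tonelli (m1 := @volS3 R) (m2 := mu) f mf f0).
under eq_integral do rewrite inner2.
rewrite -integral_mkcond.
rewrite (@eq_integral _ _ _ mu _
  (fun l => (2 * pi ^+ 2)%:E * (chord_kernel l * cap_fraction l)%:E)%E); last first.
  by move=> l _; rewrite -EFinM mulrC.
rewrite ge0_integralZl_EFin//; last 3 first.
- move=> l; rewrite /= in_itv/= => lI.
  by rewrite lee_fin mulr_ge0 ?chord_kernel_ge0 ?cap_fraction_ge0//; case/andP: lI.
- apply/measurable_EFinP; apply: measurable_funTS.
  by apply: measurable_funM;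
    [exact: measurable_chord_kernel|exact: measurable_cap_fraction].
- by rewrite mulr_ge0// sqr_ge0.
rewrite integral_chord_kernel_cap_fraction -EFinM -EFinD; congr EFin; ring.
Qed.


Context (A : configuration R).

Lemma mean_PhiE : mean_Phi A = total_mass A * (16 / (3 * pi)).
Proof.
have p0 := pi_gt0 R; rewrite /mean_Phi /Rintegral.
pose h (n : 'I_(npunct A)) x := ((sin (geodist x (puncture n) / 2))^-1)%:E : \bar R.
rewrite (@eq_integral _ _ _ _ _
    (fun x => \sum_(n < npunct A) (mass n)%:E * h n x)%E); last first.
  by move=> x _; rewrite sumEFin; congr EFin; apply: eq_bigr.
have h0 n x : S3 x -> (0 <= h n x)%E.
  move=> hx; rewrite lee_fin invr_ge0 sin_ge0_pi//.
  by case/andP: (geodist_itv hx (puncture_S3 n)) => *; apply/andP; split; lra.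
have mh n : measurable_fun (@S3 R) (h n).
  apply/measurable_EFinP; apply: measurable_inv_sin_half_geodist.
  exact: puncture_S3.
rewrite ge0_integral_sum//; last 3 first.
- exact: measurable_S3.
- by move=> n; apply: measurable_funeM.
- by move=> n x hx; rewrite mule_ge0 ?h0// lee_fin ltW// mass_gt0.
rewrite (eq_bigr (fun n => (mass n * (2 * pi ^+ 2 * (16 / (3 * pi))))%:E)); last first.
  move=> n _; rewrite ge0_integralZl_EFin ?(ltW (mass_gt0 n))//.
  - by rewrite integral_inv_sin_half_geodist// ; exact: puncture_S3.
  - exact: measurable_S3.
  - by move=> x; exact: h0.
rewrite sumEFin/= -mulr_suml -/(total_mass A).
by move: (@pi R) (lt0r_neq0 p0) => P P0; field.
Qed.

End MeanPotential.

(** * The deviation as an integral of the discrepancy *)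

Section Deviation.
Context {R : realType}.
Implicit Types (l t : R) (p q x y : R4 R).
Local Notation mu := (@lebesgue_measure R).

Lemma integrable_ge0_itv (f : R -> R) (r : R) : measurable_fun setT f ->
  (forall l, 0 <= l <= pi -> 0 <= f l) ->
  (\int[mu]_(l in `[0%R, pi]) (f l)%:E = r%:E)%E ->
  mu.-integrable `[0, pi]%classic (EFin \o f).
Proof.
move=> mf f0 If; apply/integrableP; split.
  by apply/measurable_EFinP; exact: measurable_funTS.
have E : (\int[mu]_(l in `[0%R, pi]) `|(f l)%:E| = r%:E)%E.
  rewrite -If; apply: eq_integral => l; rewrite inE/= in_itv/= => lI.
  by rewrite ger0_norm ?f0.
apply: (@le_lt_trans _ _ r%:E); last exact: ltry.
by rewrite -E.
Qed.

Lemma ge0_integralZl_itv (f : R -> R) (k r : R) : 0 <= k ->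
  measurable_fun setT f -> (forall l, 0 <= l <= pi -> 0 <= f l) ->
  (\int[mu]_(l in `[0%R, pi]) (f l)%:E = r%:E)%E ->
  (\int[mu]_(l in `[0%R, pi]) (k * f l)%:E = (k * r)%:E)%E.
Proof.
move=> k0 mf f0 If; under eq_integral do rewrite EFinM.
rewrite ge0_integralZl_EFin ?If//.
by apply/measurable_EFinP; exact: measurable_funTS.
Qed.

Context (A : configuration R).

Lemma total_mass_gt0 : 0 < total_mass A.
Proof.
rewrite /total_mass; move: (@mass_gt0 R A) (npunct_gt0 A); move: (@mass R A).
case: (npunct A) => // n m m0 _.
rewrite big_ord_recl ltr_wpDr ?m0// sumr_ge0// => i _; exact: ltW.
Qed.

Lemma discE p l : S3 p -> 0 <= l <= pi -> total_mass A * disc A p l =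
  total_mass A * cap_fraction l
  - \sum_(n < npunct A) mass n * (geodist p (puncture n) <= l)%R%:R.
Proof.
move=> hp lI; have a0 := total_mass_gt0; have p0 := pi_gt0 R.
rewrite /disc volS3_cap//= mulKf; last by rewrite gt_eqF// mulr_gt0// exprn_gt0.
rewrite mulrBr; congr (_ - _).
rewrite big_mkcond mulr_sumr; apply: eq_bigr => n _ /=.
have -> : (puncture n \in cap p l) = (geodist p (puncture n) <= l).
  apply/idP/idP; rewrite inE /cap/=; first by case.
  by move=> h; split=> //; exact: puncture_S3.
case: ifP => _; last by rewrite !mulr0.
by rewrite mulr1 mulrC divfK// gt_eqF.
Qed.

(** The puncture part and the volume part are integrated separately: each is nonnegative with a
    known finite integral, which gives integrability of their difference. *)
Lemma Phi_deviation_le p eps U : S3 p ->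
  (forall n : 'I_(npunct A), p <> puncture n) -> 0 < eps ->
  (forall l, 0 <= l <= pi -> `|disc A p l| <= U * capV l `^ (1 + eps)) ->
  `|Phi A p - mean_Phi A| <= total_mass A * U *
    \int[mu]_(l in `[0, pi]%classic) (chord_kernel l * capV l `^ (1 + eps)).
Proof.
move=> hp hpA e0 hU; have a0 := total_mass_gt0; have p0 := pi_gt0 R.
have mD : measurable (`[0, pi]%classic : set R) by exact: measurable_itv.
pose d n := geodist p (@puncture R A n).
have dI n : 0 < d n <= pi.
  have := geodist_gt0 hp (puncture_S3 n) (hpA n).
  by rewrite -/(d n) => ->; case/andP: (geodist_itv hp (puncture_S3 n)).
(* [S] integrates to Phi(p) - alpha and [w] to <Phi> - alpha. The two alpha cancel, and [w l - S l]
   is the kernel times alpha disc_p(l). *)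
pose u n l := mass n * (chord_kernel l * (d n <= l)%R%:R).
pose S l := \sum_(n < npunct A) u n l.
pose w l := total_mass A * (chord_kernel l * cap_fraction l).
have mk n : measurable_fun setT (fun l => chord_kernel l * (d n <= l)%R%:R).
  apply: measurable_funM.
    exact: measurable_chord_kernel.
  rewrite (_ : (fun l => _) = \1_(`[d n, +oo[%classic)).
    by apply: measurable_indic; exact: measurable_itv.
  by apply/funext => l; rewrite indicE mem_setE in_itv/= andbT.
have mu_ n : measurable_fun setT (u n) by exact: measurable_funM.
have mkw : measurable_fun setT (fun l : R => chord_kernel l * cap_fraction l).
  by apply: measurable_funM;
    [exact: measurable_chord_kernel|exact: measurable_cap_fraction].
have mw : measurable_fun setT w by exact: measurable_funM.
have u0 n l : 0 <= l <= pi -> 0 <= u n l.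
  move=> lI; rewrite mulr_ge0 ?(ltW (mass_gt0 n))// mulr_ge0//.
  exact: chord_kernel_ge0.
have w0 l : 0 <= l <= pi -> 0 <= w l.
  move=> lI; rewrite mulr_ge0 ?(ltW a0)// mulr_ge0 ?chord_kernel_ge0//.
  by rewrite cap_fraction_ge0//; case/andP: lI.
have IS : (\int[mu]_(l in `[0%R, pi]) (S l)%:E = (Phi A p - total_mass A)%:E)%E.
  under eq_integral do rewrite -sumEFin.
  rewrite ge0_integral_sum//; last first.
    by move=> n; apply/measurable_EFinP; apply: measurable_funTS; exact: mu_.
  rewrite (eq_bigr (fun n => (mass n * ((sin (d n / 2))^-1 - 1))%:E)); last first.
    move=> n _; apply: (ge0_integralZl_itv (ltW (mass_gt0 n)) (mk n)).
      by move=> l lI; rewrite mulr_ge0 ?chord_kernel_ge0.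
    exact: integral_chord_kernel_indic.
  rewrite sumEFin; congr EFin; rewrite /Phi /total_mass -sumrB.
  by apply: eq_bigr => n _; rewrite mulrBr mulr1.
have Iw : (\int[mu]_(l in `[0%R, pi]) (w l)%:E = (mean_Phi A - total_mass A)%:E)%E.
  rewrite mean_PhiE -[X in (_ - X)%:E]mulr1 -mulrBr.
  apply: (ge0_integralZl_itv (ltW a0) mkw).
    move=> l lI; rewrite mulr_ge0 ?chord_kernel_ge0//.
    by rewrite cap_fraction_ge0//; case/andP: lI.
  exact: integral_chord_kernel_cap_fraction.
have iS : mu.-integrable `[0, pi]%classic (EFin \o S).
  apply: integrable_ge0_itv IS; first exact: measurable_sum.
  by move=> l lI; apply: sumr_ge0 => n _; exact: u0.
have iw : mu.-integrable `[0, pi]%classic (EFin \o w).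
  exact: integrable_ge0_itv Iw.
have iV := integrable_chord_kernel_capV e0.
have iwS := @integrableB _ (measurableTypeR R) R lebesgue_measure _ mD _ _ iw iS.
have E : mean_Phi A - Phi A p = \int[mu]_(l in `[0, pi]%classic) (w l - S l).
  rewrite RintegralB// /Rintegral IS Iw/=; ring.
have pt (l : R) : 0 <= l <= pi -> `|w l - S l| <=
    total_mass A * U * (chord_kernel l * capV l `^ (1 + eps)).
  move=> lI; have -> : w l - S l = chord_kernel l * (total_mass A * disc A p l).
    rewrite discE// mulrBr /w mulrCA; congr (_ - _).
    by rewrite mulr_sumr; apply: eq_bigr => n _; rewrite /u mulrCA.
  rewrite normrM (ger0_norm (chord_kernel_ge0 lI)) normrM (gtr0_norm a0).
  have := ler_wpM2l (mulr_ge0 (chord_kernel_ge0 lI) (ltW a0)) (hU _ lI).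
  rewrite -mulrA => h; apply: (le_trans h); rewrite le_eqVlt; apply/orP; left.
  by apply/eqP; move: (chord_kernel l) (capV l `^ _) (total_mass A) => K V a; ring.
rewrite distrC E.
apply: (le_trans (le_normr_Rintegral _ _)) => //.
rewrite -RintegralZl//; apply: le_Rintegral => //.
- exact: (@integrable_abse _ (measurableTypeR R) R lebesgue_measure _ _ iwS).
- exact: (@integrableZl _ (measurableTypeR R) R lebesgue_measure _ mD _ _ iV).
Qed.

End Deviation.

(** * Discrepancy estimates *)

Section Estimates.
Context {R : realType}.
Implicit Types (l E D lam eps : R).

(** Split l^3 as l^(2-eps) l^(1+eps): the first factor is at most lam^(2-eps), the second at most
    (pi sin l)^(1+eps). The constants combine as 2 / (3 pi) * pi^(1+eps) = 2 pi^eps / 3. *)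
Lemma U1_bound eps lam E l : 0 < eps -> eps <= 1 -> lam <= pi / 2 ->
  0 <= l -> l < lam ->
  cap_fraction l <= U1 eps E lam * capV l `^ (1 + eps).
Proof.
move=> e0 e1 lamp l0 llam; have p0 := pi_gt0 R; have p2 := pi_ge2 R.
rewrite /U1; move: l0; rewrite le_eqVlt => /predU1P[<-|l0].
  by rewrite cap_fraction0 !mulr_ge0 ?powR_ge0 ?invr_ge0.
apply: (le_trans (cap_fraction_le_cube (ltW l0))).
rewrite /capV ifT; last by lra.
have sl : l <= pi * sin l.
  have h : l / 2 <= sin l by apply: sin_ge_half; apply/andP; split; lra.
  have h2 : 2 * sin l <= pi * sin l by rewrite ler_wpM2r//; lra.
  lra.
have s0 : 0 <= sin l by apply: sin_ge0_pi; apply/andP; split; lra.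
have e1' : 0 <= 1 + eps by lra.
have h1 : l `^ (1 + eps) <= pi `^ (1 + eps) * sin l `^ (1 + eps).
  rewrite -powRM ?(ltW p0)//; apply: ge0_ler_powR;
    by rewrite ?nnegrE ?(ltW l0)// mulr_ge0 ?(ltW p0).
have h2 : l `^ (2 - eps) <= lam `^ (2 - eps).
  apply: ge0_ler_powR; rewrite ?nnegrE ?(ltW l0) ?(ltW llam)//; first by lra.
  by rewrite (ltW (lt_trans l0 llam)).
have -> : l ^+ 3 = l `^ (2 - eps) * l `^ (1 + eps).
  rewrite -powRD; last by rewrite (gt_eqF l0) implybT.
  by rewrite -powR_mulrn ?ltW//; congr (_ `^ _); lra.
have h3 := ler_pM (powR_ge0 l (2 - eps)) (powR_ge0 l (1 + eps)) h2 h1.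
have k0 : 0 <= 2 / (3 * pi) :> R by rewrite divr_ge0// mulr_ge0// ltW.
apply: (le_trans (ler_wpM2l k0 h3)).
rewrite (@powRD _ pi 1 eps); last by rewrite (gt_eqF p0) implybT.
rewrite powRr1 ?(ltW p0)//.
move: (pi `^ eps) (lam `^ (2 - eps)) (sin l `^ (1 + eps)) => a b c.
move: (@pi R) (lt0r_neq0 p0) => P P0.
by rewrite le_eqVlt; apply/orP; left; apply/eqP; field.
Qed.

(** With k = (1 + eps) / 2 <= 1, both terms of sin(l + E) <= sin l + E are compared with (sin l)^k:
    sin l is at most that power, and E is at most 2 E lam^(-k) times it. Squaring gives the exponent
    1 + eps. *)
Lemma U2_bound eps lam E l : 0 < eps -> eps <= 1 -> 0 < lam -> 0 <= E ->
  lam <= l -> l + E <= pi / 2 ->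
  4 * E / pi * sin (l + E) ^+ 2 <= U2 eps E lam * capV l `^ (1 + eps).
Proof.
move=> e0 e1 lam0 E0 laml lE; have p0 := pi_gt0 R.
rewrite /U2 /capV ifT; last by lra.
set k := (1 + eps) / 2.
have s0 : 0 < sin l by apply: sin_gt0_pi; apply/andP; split; lra.
have sE : sin (l + E) <= sin l + E.
  rewrite sinD.
  have hE : sin E <= E := sin_le_id E0.
  have hE0 : 0 <= sin E by apply: sin_ge0_pi; apply/andP; split; lra.
  have cl0 : 0 <= cos l by apply: cos_ge0_pihalf; apply/andP; split; lra.
  have h1 : sin l * cos E <= sin l * 1 by rewrite ler_wpM2l ?cos_le1// ltW.
  have h2 : cos l * sin E <= 1 * E by apply: ler_pM => //; exact: cos_le1.
  lra.
have slE0 : 0 <= sin (l + E) by apply: sin_ge0_pi; apply/andP; split; lra.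
have Sk : sin l <= sin l `^ k.
  rewrite -[leLHS]powRr1 ?(ltW s0)//; apply: ger_powR; first by rewrite s0 sin_le1.
  by rewrite /k; lra.
(* Origin of the 2 in [U2]: sin l >= l / 2 >= lam / 2, and (1/2)^k >= 1/2 because k <= 1. *)
have h : 1 <= 2 * lam `^ (- k) * sin l `^ k.
  have sl : l / 2 <= sin l by apply: sin_ge_half; apply/andP; split; lra.
  have h1 : (lam / 2) `^ k <= sin l `^ k.
    by apply: ge0_ler_powR; rewrite ?nnegrE /k; lra.
  have h2 : 2^-1 <= 2^-1 `^ k :> R.
    rewrite -[leLHS]powRr1//; apply: ger_powR; last by rewrite /k; lra.
    by apply/andP; split; lra.
  have lk : 0 < lam `^ k by exact: powR_gt0.
  move: h1; rewrite powRM ?(ltW lam0)// => h1.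
  rewrite powRN.
  have h3 : lam `^ k * 2^-1 <= sin l `^ k.
    by apply: le_trans h1; rewrite ler_wpM2l// ltW.
  rewrite mulrAC ler_pdivlMr// mul1r; lra.
have F : sin (l + E) <= (1 + 2 * E * lam `^ (- k)) * sin l `^ k.
  apply: (le_trans sE); rewrite mulrDl mul1r lerD//.
  have := ler_wpM2l E0 h; rewrite mulr1.
  by move: (lam `^ (- k)) (sin l `^ k) => a b; rewrite !mulrA (mulrC E 2).
have E4 : 0 <= 4 * E / pi by rewrite divr_ge0 ?mulr_ge0// ltW.
have -> : sin l `^ (1 + eps) = (sin l `^ k) ^+ 2.
  by rewrite -powR_mulrn ?powR_ge0// -powRrM; congr (_ `^ _); rewrite /k; lra.
rewrite -[X in _ <= X]mulrA -exprMn ler_wpM2l// ler_pXn2r// nnegrE.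
exact: le_trans F.
Qed.

(** V is nondecreasing and l >= pi / 2 - E, so V(l) is at least sin(pi/2 - E) = cos E, which is
    positive. *)
Lemma U3_bound eps lam E l : 0 < eps -> 0 <= E -> E < pi / 2 ->
  pi / 2 <= l + E -> 0 <= l <= pi ->
  4 * E / pi <= U3 eps E lam * capV l `^ (1 + eps).
Proof.
move=> e0 E0 Ep lE /andP[l0 lpi]; have p0 := pi_gt0 R.
have c0 : 0 < cos E by apply: cos_gt0_pihalf; apply/andP; split; lra.
have cV : cos E <= capV l.
  rewrite /capV; case: ifPn => [lp|_]; last exact: cos_le1.
  have -> : cos E = sin (pi / 2 - E).
    by rewrite sinB sin_pihalf cos_pihalf mul1r mul0r subr0.
  by rewrite leNgt ltr_sin ?in_itv/= -?leNgt; try (apply/andP; split); lra.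
have h : cos E `^ (1 + eps) <= capV l `^ (1 + eps).
  by apply: ge0_ler_powR => //; rewrite ?nnegrE; lra.
have ck : 0 < cos E `^ (1 + eps) by exact: powR_gt0.
rewrite /U3 invfM !mulrA -[leLHS]mulr1 -[in X in _ <= X]mulrA ler_wpM2l//.
  by rewrite divr_ge0 ?mulr_ge0// ltW.
by rewrite mulrC ler_pdivlMr// mul1r.
Qed.

End Estimates.

(** * From the infima and the supremum to pointwise bounds on the discrepancy *)

Section Discrepancy.
Context {R : realType}.
Context (A : configuration R).
Implicit Types (l D : R) (p q : R4 R).

Lemma disc_le1 p l : S3 p -> 0 <= l <= pi -> `|disc A p l| <= 1.
Proof.
move=> hp lI; have a0 := total_mass_gt0 A.
rewrite -(ler_pM2l a0) mulr1 -{1}(gtr0_norm a0) -normrM discE//.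
set S := \sum_(n < _) _.
have S0 : 0 <= S.
  by apply: sumr_ge0 => n _; rewrite mulr_ge0 ?(ltW (mass_gt0 n)).
have Sa : S <= total_mass A.
  apply: ler_sum => n _; rewrite ler_piMr ?(ltW (mass_gt0 n))//.
  by case: (geodist _ _ <= l); rewrite ?lexx ?ler01.
have W0 : 0 <= cap_fraction l by apply: cap_fraction_ge0; case/andP: lI.
have W1 : cap_fraction l <= 1.
  by rewrite -(@cap_fractionpi R); apply: cap_fraction_nondecreasing; case/andP: lI.
have aW0 : 0 <= total_mass A * cap_fraction l by rewrite mulr_ge0// ltW.
have aW1 : total_mass A * cap_fraction l <= total_mass A by rewrite ler_piMr// ltW.
rewrite ler_norml; apply/andP; split; lra.
Qed.

Let admissible p :=
  [set D | 0 <= D /\ forall l, 0 <= l <= pi -> `|disc A p l| <= capF D l].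

(** F with D = pi / 2 is the constant 2, while |disc| <= 1. Hence the infimum is over a nonempty
    set, and the supremum over a set bounded by pi / 2. *)
Lemma admissible_pihalf p : S3 p -> admissible p (pi / 2).
Proof.
move=> hp; have p0 := pi_gt0 R; split; first by lra.
move=> l lI; apply: (le_trans (disc_le1 hp lI)).
have -> : capF (pi / 2) l = 2 :> R; last by lra.
have e : 4 * (pi / 2) / pi = 2 :> R.
  by move: (@pi R) (lt0r_neq0 p0) => P P0; field.
rewrite /capF e; case: ifP => // h.
have -> : l = 0 by case/andP: lI => *; lra.
by rewrite add0r sin_pihalf expr1n mulr1.
Qed.

Lemma admissible_lbound p : has_lbound (admissible p).
Proof. by exists 0 => D []. Qed.

Lemma mod_disc_le p : S3 p -> mod_disc A p <= pi / 2.
Proof.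
by move=> hp; apply: ge_inf; [exact: admissible_lbound|exact: admissible_pihalf].
Qed.

Lemma mod_disc_ge0 p : S3 p -> 0 <= mod_disc A p.
Proof.
move=> hp; apply: lb_le_inf; last by move=> D [].
by exists (pi / 2); exact: admissible_pihalf.
Qed.

Lemma mod_disc_le_glob p : S3 p -> mod_disc A p <= glob_mod_disc A.
Proof.
move=> hp; apply: ub_le_sup; last by exists p.
by exists (pi / 2) => _ [q hq <-]; exact: mod_disc_le.
Qed.

Lemma glob_mod_disc_ge0 : 0 <= glob_mod_disc A.
Proof. exact: le_trans (mod_disc_ge0 S3_north) (mod_disc_le_glob S3_north). Qed.

(** Some admissible D' lies below D. The bound passes from D' to D since 4D / pi increases and the
    sine increases up to pi / 2. *)
Lemma disc_le_gt_glob p l D : S3 p -> 0 <= l <= pi -> glob_mod_disc A < D ->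
  `|disc A p l| <= 4 * D / pi /\
  (l + D <= pi / 2 -> `|disc A p l| <= 4 * D / pi * sin (l + D) ^+ 2).
Proof.
move=> hp lI hD; have p0 := pi_gt0 R; have /andP[l0 lpi] := lI.
have : mod_disc A p < D by exact: le_lt_trans (mod_disc_le_glob hp) hD.
move=> /inf_lt; case; first by exists (pi / 2); exact: admissible_pihalf.
move=> D' [D'0 /(_ _ lI) hD'] D'D.
have k0 : 0 <= 4 * D' / pi by rewrite divr_ge0 ?mulr_ge0// ltW.
have kD : 4 * D' / pi <= 4 * D / pi by rewrite ler_pM2r ?invr_gt0// ler_pM2l// ltW.
have s1 t : sin t ^+ 2 <= 1 :> R.
  by rewrite sin2cos2 gerBl sqr_ge0.
split=> [|lD].
  apply: (le_trans hD'); rewrite /capF; case: ifP => // _.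
  by apply: le_trans kD; rewrite ler_piMr.
apply: (le_trans hD'); rewrite /capF ifT; last by lra.
apply: ler_pM => //; first exact: sqr_ge0.
rewrite ler_pXn2r ?nnegrE//.
- by rewrite leNgt ltr_sin ?in_itv/= -?leNgt; try (apply/andP; split); lra.
- by apply: sin_ge0_pi; apply/andP; split; lra.
- by apply: sin_ge0_pi; apply/andP; split; lra.
Qed.

Lemma disc_le_glob p l (E := glob_mod_disc A) : S3 p -> 0 <= l <= pi ->
  `|disc A p l| <= 4 * E / pi.
Proof.
move=> hp lI; have p0 := pi_gt0 R; apply/ler_addgt0Pr => e e0.
(* The increment is chosen so that 4D / pi exceeds 4E / pi by exactly [e]. *)
have [|h _] := @disc_le_gt_glob p l (E + e * pi / 4) hp lI.
  by rewrite ltrDl divr_gt0// mulr_gt0.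
apply: (le_trans h); rewrite le_eqVlt; apply/orP; left; apply/eqP.
by move: (@pi R) (lt0r_neq0 p0) => P P0; field.
Qed.

Lemma disc_le_glob_sin p l (E := glob_mod_disc A) : S3 p -> 0 <= l <= pi ->
  l + E <= pi / 2 -> `|disc A p l| <= 4 * E / pi * sin (l + E) ^+ 2.
Proof.
(* When l + E = pi / 2 no D > E satisfies l + D <= pi / 2, but the sine is 1 and the constant bound
   suffices. Otherwise D decreases to E within the admissible range. *)
move=> hp lI; have p0 := pi_gt0 R; rewrite le_eqVlt => /predU1P[->|lE].
  by rewrite sin_pihalf expr1n mulr1; exact: disc_le_glob.
pose f (D : R) := 4 * D / pi * sin (l + D) ^+ 2.
have cf : f D @[D --> E^'+] --> f E.
  notypeclasses refine (@is_derive_cvg_right _ f E _ _).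
  by rewrite /f; repeat derive_step.
rewrite -/(f E) -(cvg_lim _ cf)//; apply: limr_ge; first by apply: cvgP cf.
near=> D.
have DE : E < D by near: D; exact: nbhs_right_gt.
have [_] := disc_le_gt_glob hp lI DE; apply.
have : D <= pi / 2 - l by near: D; apply: nbhs_right_le; lra.
lra.
Unshelve. all: by end_near. Qed.

Lemma disc_bound p eps l : S3 p -> (forall n : 'I_(npunct A), p <> puncture n) ->
  0 < eps -> eps <= 1 -> glob_mod_disc A + lambda_min A p < pi / 2 ->
  0 <= l <= pi ->
  `|disc A p l| <= Umax eps (glob_mod_disc A) (lambda_min A p) * capV l `^ (1 + eps).
Proof.
move=> hp hpA e0 e1 hE lI; have p0 := pi_gt0 R; have /andP[l0 lpi] := lI.
have E0 := glob_mod_disc_ge0.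
set E := glob_mod_disc A in hE E0 *; set lam := lambda_min A p in hE *.
have lam0 : 0 < lam.
  apply: lt_bigmin => // n _; apply: geodist_gt0 => //; exact: puncture_S3.
have V0 : 0 <= capV l `^ (1 + eps) by exact: powR_ge0.
have [llam|laml] := ltP l lam.
  have -> : disc A p l = cap_fraction l.
    have a0 := total_mass_gt0 A.
    apply: (mulfI (lt0r_neq0 a0)); rewrite discE// big1 ?subr0// => n _.
    rewrite leNgt (lt_le_trans llam) ?mulr0//.
    exact: bigmin_le.
  rewrite ger0_norm ?cap_fraction_ge0//.
  apply: (@le_trans _ _ (U1 eps E lam * capV l `^ (1 + eps))).
    by apply: U1_bound => //; lra.
  by rewrite ler_wpM2r// /Umax !le_max lexx.
have [lE|lE] := leP (l + E) (pi / 2).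
  apply: (le_trans (disc_le_glob_sin hp lI lE)).
  apply: (@le_trans _ _ (U2 eps E lam * capV l `^ (1 + eps))).
    exact: U2_bound.
  by rewrite ler_wpM2r// /Umax !le_max lexx orbT.
apply: (le_trans (disc_le_glob hp lI)).
apply: (@le_trans _ _ (U3 eps E lam * capV l `^ (1 + eps))).
  by apply: U3_bound => //; rewrite -/E; lra.
by rewrite ler_wpM2r// /Umax !le_max lexx !orbT.
Qed.

(** On ]0, pi] the derivative is -K with K >= 0. At 0, where 1 / sin(t/2) has only its conventional
    value, the factor [capV 0 = 0] annihilates both integrands. *)
Lemma CepsE eps : 0 < eps -> Ceps eps = 3 * pi / 16 *
  \int[@lebesgue_measure R]_(l in `[0, pi]%classic)
    (chord_kernel l * capV l `^ (1 + eps)).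
Proof.
move=> e0; rewrite /Ceps; congr (_ * _); apply: eq_Rintegral => l.
rewrite inE/= in_itv/= => lI; have /andP[l0 lpi] := lI.
move: l0; rewrite le_eqVlt => /predU1P[<-|l0].
  rewrite /capV divr_ge0 ?pi_ge0// sin0 powR0 ?mulr0//.
  by rewrite gt_eqF// addr_gt0.
rewrite derive1_inv_sin_half ?l0// normrN ger0_norm//.
exact: chord_kernel_ge0.
Qed.

End Discrepancy.

Theorem theorem3p1 (R : realType) (A : configuration R) (p : R4 R) (eps : R)
    (hp : S3 p) (hpA : forall n : 'I_(npunct A), p <> puncture n)
    (heps0 : 0 < eps) (heps1 : eps <= 1)
    (hE : glob_mod_disc A + lambda_min A p < pi / 2) :
  `|Phi A p - mean_Phi A| / mean_Phi A
    <= Ceps eps * Umax eps (glob_mod_disc A) (lambda_min A p).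
Proof.
have p0 := pi_gt0 R; have a0 := total_mass_gt0 A.
have mean0 : 0 < mean_Phi A.
  by rewrite mean_PhiE mulr_gt0// divr_gt0// mulr_gt0.
rewrite ler_pdivrMr//.
have := Phi_deviation_le hp hpA heps0
  (fun l lI => disc_bound hp hpA heps0 heps1 hE lI).
move=> /le_trans; apply; rewrite CepsE// mean_PhiE.
set I := Rintegral _ _ _; set U := Umax _ _ _.
(* Both sides are equal: 3 pi / 16 in [Ceps] cancels 16 / (3 pi) in the mean. *)
rewrite le_eqVlt; apply/orP; left; apply/eqP.
by move: (@pi R) (lt0r_neq0 p0) => P P0; field.
Qed.
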